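(* Let $H$ be a hero and let $k,\alpha\ge 2$ be integers. The set $\{\overleftrightarrow{K_k}, \overline{K}_\alpha, H\}$ is heroic if and only if $H$ is a transitive tournament or $k=2$.
   Context: Digraphs have no loops and no parallel arcs, but both $xy$ and $yx$ may be arcs. The dichromatic number $\vec\chi(D)$ of a digraph $D$ is the minimum number of colors in a vertex coloring in which no color class induces a directed cycle. For a set $\mathcal F$ of digraphs, $Forb_{ind}(\mathcal F)$ is the class of digraphs containing no member of $\mathcal F$ as an induced subdigraph; $\mathcal F$ is heroic if $Forb_{ind}(\mathcal F)$ has bounded dichromatic number. $\overleftrightarrow{K_k}$ is the complete symmetric digraph on $k$ vertices (every pair joined by arcs in both directions); $\overline{K}_\alpha$ is the digraph on $\alpha$ vertices with no arcs. A tournament is an orientation of a complete graph; a transitive tournament is one with no directed cycle. A hero is a tournament $H$ such that the class of tournaments not containing $H$ as an induced subdigraph has bounded dichromatic number (equivalently, $\{\overleftrightarrow{K_2},\overline{K}_2,H\}$ is heroic). *)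

(* Defs.v *)
From HB Require Import structures.
From mathcomp Require Import all_boot.
From mathcomp Require Import boolp.
Set Implicit Arguments.
Unset Strict Implicit.
Unset Printing Implicit Defensive.

Record digraph := Digraph {
  vertex :> finType;
  arc : rel vertex;
  arc_irrefl : irreflexive arc
}.

(* Two opposite arcs form a directed cycle of length 2; length 1 is ruled out
   by [arc_irrefl]. *)
Definition has_directed_cycle (D : digraph) : Prop :=
  exists s : seq D, s <> [::] /\ ucycle (@arc D) s.

Definition acyclic (D : digraph) : Prop := ~ has_directed_cycle D.

Definition induced_arc (D : digraph) (P : pred D) : rel {x : D | P x} :=
  fun x y => arc (val x) (val y).

Lemma induced_arc_irrefl (D : digraph) (P : pred D) :
  irreflexive (@induced_arc D P).
Proof. by move=> x; rewrite /induced_arc arc_irrefl. Qed.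

Definition induced (D : digraph) (P : pred D) : digraph :=
  Digraph (@induced_arc_irrefl D P).

Definition digraph_iso (D1 D2 : digraph) : Prop :=
  exists f : D1 -> D2, bijective f /\ forall x y, arc (f x) (f y) = arc x y.

Definition contains_induced (D F : digraph) : Prop :=
  exists P : pred D, digraph_iso F (induced P).

Definition dicoloring (D : digraph) (m : nat) (c : D -> 'I_m) : Prop :=
  forall i : 'I_m, acyclic (induced (fun x => c x == i)).

Definition dicolorable (D : digraph) (m : nat) : Prop :=
  exists c : D -> 'I_m, dicoloring c.

Lemma dicolorable_card (D : digraph) : dicolorable D #|D|.
Proof.
exists enum_rank => i [s [s_neq0 /andP[]]].
case: s s_neq0 => [//|x s] _.
have eqx y : y = x.
  apply: val_inj; apply: enum_rank_inj.
  by rewrite (eqP (valP y)) (eqP (valP x)).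
case: s => [|y s]; first by rewrite /= induced_arc_irrefl.
by rewrite (eqx y) /= inE eqxx.
Qed.

Lemma ex_dicolorable (D : digraph) : exists m, `[< dicolorable D m >].
Proof. by exists #|D|; apply/asboolP/dicolorable_card. Qed.

Definition dichromatic_number (D : digraph) : nat := ex_minn (ex_dicolorable D).

(* A class or set of digraphs is a predicate: the universe constraints of
   [classical_sets] do not allow [set digraph]. *)
Definition digraph_class := digraph -> Prop.

Definition bounded_dichromatic_number (C : digraph_class) : Prop :=
  exists m : nat, forall D : digraph, C D -> dichromatic_number D <= m.

Definition Forb_ind (FF : digraph_class) : digraph_class :=
  fun D => forall F : digraph, FF F -> ~ contains_induced D F.

Definition heroic (FF : digraph_class) : Prop :=
  bounded_dichromatic_number (Forb_ind FF).

Definition triple (A B C : digraph) : digraph_class :=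
  fun F => F = A \/ F = B \/ F = C.

Lemma neq_irrefl (T : eqType) : irreflexive (fun x y : T => x != y).
Proof. by move=> x; rewrite eqxx. Qed.

Definition complete_symmetric (k : nat) : digraph :=
  Digraph (@neq_irrefl 'I_k).

Definition edgeless (n : nat) : digraph :=
  @Digraph 'I_n (fun _ _ => false) (fun _ => erefl).

Definition tournament (D : digraph) : Prop :=
  forall x y : D, x != y -> arc x y (+) arc y x.

Definition transitive_tournament (D : digraph) : Prop :=
  tournament D /\ acyclic D.

Definition hero (H : digraph) : Prop :=
  tournament H /\
  bounded_dichromatic_number
    (fun T => tournament T /\ ~ contains_induced T H).

(* Main.v *)
From mathcomp Require Import all_boot.
From mathcomp Require Import boolp zify.
Require Import Defs.
Set Implicit Arguments.
Unset Strict Implicit.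
Unset Printing Implicit Defensive.

(** If [H] is not transitive and [k >= 3], turn the edges of a triangle-free graph of
    large chromatic number into digons and orient all other pairs along a linear
    order: this digraph has no three mutual digons, no two nonadjacent vertices and no induced
    directed triangle. If [H] is transitive, Ramsey's theorem bounds the order.

    The remaining case [k = 2] says that a hero bounds the dichromatic number of oriented
    graphs of bounded independence number. Being contained in every family of tournaments of
    unbounded dichromatic number, a hero embeds in the nested triangles
    [S_(n+1) = Delta(1, S_n, S_n)] and avoids [Delta(1, C3, C3)], since the latter is not
    contained in a tournament whose backward arcs form a graph without cycles of length 3 and 5.
    So it embeds in a pattern built from single vertices by ordered sums [p => q] and
    by [Delta(1, TT_k, p)] and [Delta(1, p, TT_k)].

    For such a pattern one shows that large dichromatic number forces "jewels", subsets of
    bounded size but large dichromatic number. A vertex sees a jewel in boundedly many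
    ways, which settles ordered sums at once. For [Delta(1, TT_k, p)] one takes a longest
    chain of sets of large dichromatic number with few arcs going back; it
    splits the digraph into zones of bounded dichromatic number, and the arcs jumping back over
    a set of the chain have bounded out-degree. *)


(** * Dicolourings and patterns *)

Section Coloring.
Context {T : finType}.
Implicit Types (e : rel T) (A B X Y J K : {set T}).

Definition oriented e := forall x y, e x y -> ~~ e y x.

(* On finite sets this is the absence of directed cycles. *)
Definition acy e X := forall Y, Y \subset X -> Y != set0 ->
  exists2 y, y \in Y & {in Y, forall z, ~~ e y z}.

(** Colours are natural numbers and [c] is defined on all of [T], so that colourings of different
    subsets of one type combine without subtypes. *)
Definition col e n X := exists2 c : T -> nat,
  {in X, forall x, c x < n} & forall i, acy e [set x in X | c x == i].

Definition outn e v := [set w | e v w].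
Definition inn e v := [set w | e w v].
Definition nonn e v := [set w | [&& w != v, ~~ e v w & ~~ e w v]].

(** Because of the empty set, the strict bound makes [alpha_lt e 0] absurd, which gives the
    inductions on [a] a vacuous base. *)
Definition alpha_lt e a X := forall I : {set T}, I \subset X ->
  {in I &, forall x y, ~~ e x y} -> #|I| < a.

Definition jewel e r N X := exists J, [/\ J \subset X, #|J| <= N & ~ col e r J].

Definition full e A B := {in A & B, forall x y, e x y}.

Definition converse e : rel T := fun x y => e y x.

Lemma oriented_irr e x : oriented e -> e x x = false.
Proof. by move=> oe; apply/negP => exx; move: (oe _ _ exx); rewrite exx. Qed.

Lemma acy_sub e A B : A \subset B -> acy e B -> acy e A.
Proof. by move=> sAB aB Y sYA; apply: aB; apply: subset_trans sAB. Qed.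

Lemma acy_tri e X x y z : acy e X -> x \in X -> y \in X -> z \in X ->
  e x y -> e y z -> e z x -> False.
Proof.
move=> aX Xx Xy Xz exy eyz ezx.
have [||w] := aX [set x; y; z].
- by apply/subsetP => w; rewrite !inE => /orP[/orP[]|] /eqP->.
- by apply/set0Pn; exists x; rewrite !inE eqxx.
rewrite !inE => /orP[/orP[]|] /eqP->.
- by move=> /(_ y); rewrite !inE eqxx orbT exy => /(_ isT).
- by move=> /(_ z); rewrite !inE eqxx orbT eyz => /(_ isT).
- by move=> /(_ x); rewrite !inE eqxx ezx => /(_ isT).
Qed.

Lemma col_sub e n A B : A \subset B -> col e n B -> col e n A.
Proof.
move=> sAB [c cn ac]; exists c => [x /(subsetP sAB)/cn //|i].
apply: acy_sub (ac i); apply/subsetP => x; rewrite !inE => /andP[Ax ->].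
by rewrite (subsetP sAB).
Qed.

Lemma col_leq e m n X : m <= n -> col e m X -> col e n X.
Proof.
by move=> mn [c cn ac]; exists c => // x Xx; apply: leq_trans mn; apply: cn.
Qed.

Lemma col_set0 e n : col e n set0.
Proof.
exists (fun=> 0) => [x|i]; first by rewrite inE.
move=> Y sY /set0Pn[x /(subsetP sY)].
by rewrite !inE.
Qed.

Lemma col0 e X : col e 0 X -> X = set0.
Proof.
move=> [c c0 _]; apply/eqP; rewrite -subset0; apply/subsetP => x Xx.
by have := c0 _ Xx.
Qed.

Lemma not_col_nonempty e n X : ~ col e n X -> exists x, x \in X.
Proof.
move=> nX; have [X0|/set0Pn//] := eqVneq X set0.
by case: nX; rewrite X0; apply: col_set0.
Qed.

Lemma colU e m n A B : col e m A -> col e n B -> col e (m + n) (A :|: B).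
Proof.
move=> [cA cAm aA] [cB cBn aB].
exists (fun x => if x \in A then cA x else m + cB x) => [x|i].
  rewrite inE; case: ifP => [/cAm|_ /= /cBn]; lia.
have [im|im] := ltnP i m.
  apply: acy_sub (aA i); apply/subsetP => x; rewrite !inE.
  by case: ifP => [_ //|_ /= /andP[_ /eqP]]; lia.
apply: acy_sub (aB (i - m)); apply/subsetP => x; rewrite !inE.
by case: ifP => [Ax /= /eqP|_ /= /andP[-> /eqP]]; [have := cAm _ Ax|]; lia.
Qed.

Lemma col_cover2 e m n N A B X : col e m A -> col e n B ->
  X \subset A :|: B -> m + n <= N -> col e N X.
Proof.
by move=> cA cB sX mnN; apply: col_leq mnN _; apply: col_sub sX _; apply: colU.
Qed.

Lemma col_bigcup (I : finType) e n k (P : {set I}) (F : I -> {set T}) X :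
  X \subset \bigcup_(i in P) F i -> #|P| <= k ->
  {in P, forall i, col e n (F i)} -> col e (k * n) X.
Proof.
move=> sX Pk cF; apply: col_sub sX _.
apply: (@col_leq _ (#|P| * n)); first by rewrite leq_mul2r Pk orbT.
rewrite cardE -big_enum /=.
have : {in enum P, forall i, col e n (F i)} by move=> i; rewrite mem_enum => /cF.
elim: (enum P) => [_|i s IH cs]; first by rewrite big_nil; apply: col_set0.
rewrite big_cons /= mulSn; apply: colU; first by apply: cs; rewrite inE eqxx.
by apply: IH => j js; apply: cs; rewrite inE js orbT.
Qed.

Lemma col_fibers e n k (f : T -> nat) X : {in X, forall x, f x < k} ->
  (forall j, j < k -> col e n [set x in X | f x == j]) -> col e (k * n) X.
Proof.
move=> fk cf.
apply: (@col_bigcup _ _ _ _ [set: 'I_k]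
          (fun j => [set x in X | f x == j])).
- apply/subsetP => x Xx; apply/bigcupP.
  by exists (Ordinal (fk _ Xx)); rewrite !inE // Xx /=.
- by rewrite cardsT card_ord.
- by move=> j _; apply: cf.
Qed.

Lemma acy1 e x : oriented e -> acy e [set x].
Proof.
move=> oe Y; rewrite subset1 => /orP[]/eqP-> => [_|/eqP//].
by exists x; rewrite ?inE // => z; rewrite inE => /eqP->; rewrite oriented_irr.
Qed.

Lemma col1 e x : oriented e -> col e 1 [set x].
Proof.
move=> oe; exists (fun=> 0) => // i; apply: acy_sub (@acy1 e x oe).
by apply/subsetP => y; rewrite inE => /andP[].
Qed.

Lemma col_card e n X : oriented e -> #|X| <= n -> col e n X.
Proof.
move=> oe Xn; rewrite -[n]muln1.
apply: (@col_bigcup _ _ _ _ X (fun x => [set x])) => //.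
  by apply/subsetP => x Xx; apply/bigcupP; exists x; rewrite ?inE.
by move=> x _; apply: col1.
Qed.

(** Used with [K] a small copy of a pattern and [F y] the vertices not joined to [y] in the wanted
    direction: what remains is completely joined to [K] and still has large dichromatic number. *)
Lemma col_rem e k d c (K : {set T}) (F : T -> {set T}) X :
  #|K| <= k -> {in K, forall y, col e d (F y)} -> ~ col e (k * d + c) X ->
  ~ col e c (X :\: \bigcup_(y in K) F y).
Proof.
move=> Kk cF nX cX; apply: nX.
apply: col_cover2 (col_bigcup _ Kk cF) cX _ (leqnn _) => //.
by apply/subsetP => x Xx; rewrite in_setU in_setD Xx andbT orbN.
Qed.

(** A missing colour [q] could replace the colour [r], leaving a colouring with [r] colours. *)
Lemma col_all_colors e r X (c : T -> nat) : ~ col e r X ->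
  {in X, forall x, c x < r.+1} -> (forall i, acy e [set x in X | c x == i]) ->
  forall q, q < r.+1 -> exists2 x, x \in X & c x = q.
Proof.
move=> nX cr ac q qr; apply: contrapT => nq; apply: nX.
have cq x : x \in X -> c x != q by move=> Xx; apply/eqP => xq; apply: nq; exists x.
exists (fun x => if c x == r then q else c x) => [x Xx|i].
  by have := cr _ Xx; have := cq _ Xx; case: (c x =P r) => [->|]; lia.
have [->|iq] := eqVneq i q.
  apply: acy_sub (ac r); apply/subsetP => x; rewrite !inE => /andP[Xx].
  by case: (c x =P r) => [_ _|_]; rewrite Xx // (negPf (cq _ Xx)).
apply: acy_sub (ac i); apply/subsetP => x; rewrite !inE => /andP[->].
by case: ifP => // _ /eqP; move/eqP: iq; lia.
Qed.

Lemma alpha_lt_sub e a A B : A \subset B -> alpha_lt e a B -> alpha_lt e a A.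
Proof. by move=> sAB sB I sI; apply: sB; apply: subset_trans sAB. Qed.

Lemma alpha_lt_nonn e a X v : oriented e -> v \in X -> alpha_lt e a.+1 X ->
  alpha_lt e a (nonn e v :&: X).
Proof.
move=> oe Xv sX I sI iI.
have vI : v \notin I.
  by apply/negP => /(subsetP sI); rewrite !inE eqxx.
have := sX (v |: I); rewrite cardsU1 vI; apply.
  apply/subsetP => x; rewrite !inE => /orP[/eqP->//|/(subsetP sI)].
  by rewrite !inE => /andP[].
move=> x y; rewrite !inE => /orP[/eqP->|xI] /orP[/eqP->|yI]; last exact: iI.
- by rewrite oriented_irr.
- by have := subsetP sI _ yI; rewrite !inE => /andP[/and3P[]].
- by have := subsetP sI _ xI; rewrite !inE => /andP[/and3P[]].
Qed.

Lemma full_sub e A A' B B' : A \subset A' -> B \subset B' -> full e A' B' -> full e A B.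
Proof. by move=> sA sB f x y /(subsetP sA) Ax /(subsetP sB) By; apply: f. Qed.

Lemma nbhd_cases e v w :
  [|| w == v, w \in outn e v, w \in inn e v | w \in nonn e v].
Proof. by rewrite !inE; case: eqP => //= _; case: (e v w) => //; case: (e w v). Qed.

Lemma nbhd_col e n1 n2 n3 v X : oriented e ->
  col e n1 (outn e v :&: X) -> col e n2 (inn e v :&: X) ->
  col e n3 (nonn e v :&: X) -> col e (n1 + n2 + n3).+1 X.
Proof.
move=> oe c1 c2 c3; apply: col_cover2 (colU (colU c1 c2) c3) (col1 v oe) _ _ => //.
  apply/subsetP => w Xw; rewrite !in_setU !in_setI Xw !andbT in_set1.
  by case/or4P: (nbhd_cases e v w) => ->; rewrite ?orbT.
by rewrite addn1.
Qed.

Lemma nbhd_colN e n1 n2 n3 v X : v \notin X ->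
  col e n1 (outn e v :&: X) -> col e n2 (inn e v :&: X) ->
  col e n3 (nonn e v :&: X) -> col e (n1 + n2 + n3) X.
Proof.
move=> vX c1 c2 c3; apply: col_cover2 (colU c1 c2) c3 _ _ => //.
apply/subsetP => w Xw; rewrite !in_setU !in_setI Xw !andbT.
case/or4P: (nbhd_cases e v w) => [/eqP wv|->|->|->]; rewrite ?orbT //.
by move: vX; rewrite -wv Xw.
Qed.

(** [acy] provides sinks, the converse asks for sources. Remove a sink [y] of [Y]: a source of the
    rest is a source of [Y], since no arc leaves [y]. *)
Lemma acy_converse e X : acy e X -> acy (converse e) X.
Proof.
move=> aX Y; move: {2}#|Y| (leqnn #|Y|) => n; elim: n Y => [|n IH] Y.
  by rewrite leqn0 cards_eq0 => ->.
move=> Yn sY Y0; have [y Yy ny] := aX Y sY Y0.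
have [D0|D0] := eqVneq (Y :\ y) set0.
  exists y => // z Yz; have [->|zy] := eqVneq z y; first exact: ny.
  by have := in_set0 z; rewrite -D0 !inE zy Yz.
have [||//|x] := IH (Y :\ y).
- by move: Yn; rewrite (cardsD1 y Y) Yy.
- by apply: subset_trans sY; apply: subsetDl.
rewrite !inE => /andP[xy Yx] nx; exists x => // z Yz.
have [->|zy] := eqVneq z y; first exact: ny.
by apply: nx; rewrite !inE zy.
Qed.

Lemma acy_converseE e X : acy (converse e) X <-> acy e X.
Proof. by split=> /acy_converse. Qed.

Lemma col_converse e n X : col (converse e) n X <-> col e n X.
Proof.
by split=> -[c cn ac]; exists c => // i; apply/acy_converseE; apply: ac.
Qed.

Lemma alpha_lt_converse e a X : alpha_lt e a X -> alpha_lt (converse e) a X.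
Proof. by move=> sX I sI iI; apply: sX => // x y Ix Iy; apply: iI. Qed.

Lemma oriented_converse e : oriented e -> oriented (converse e).
Proof. by move=> oe x y; apply: oe. Qed.

Lemma nonn_converse e v : nonn (converse e) v = nonn e v.
Proof. by apply/setP => w; rewrite !inE andbA [_ && _ && _]andbAC -andbA. Qed.

End Coloring.

(* [Seq p q] is the ordered sum [p => q]; [Tri p q] is [Delta(1, p, q)], a vertex [x] with
   [x => p => q => x]. *)
Inductive pat := One | Seq of pat & pat | Tri of pat & pat.

Fixpoint psize p := match p with
  | One => 1
  | Seq p q => psize p + psize q
  | Tri p q => (psize p + psize q).+1
  end.

Fixpoint pconv p := match p with
  | One => One
  | Seq p q => Seq (pconv q) (pconv p)
  | Tri p q => Tri (pconv q) (pconv p)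
  end.

(* The transitive tournament on [k + 1] vertices. *)
Fixpoint TT k := if k is k'.+1 then Seq One (TT k') else One.

(** * Occurrences of patterns in a set of vertices *)

Section Patterns.
Context {T : finType}.
Implicit Types (e : rel T) (A B X Y J K : {set T}).

(** For oriented [e], [full] makes the parts of an occurrence disjoint. *)
Fixpoint occ e p X : Prop := match p with
  | One => X != set0
  | Seq p q => exists A B, [/\ A \subset X, B \subset X, full e A B, occ e p A
      & occ e q B]
  | Tri p q => exists x A B, [/\ x \in X, A \subset X, B \subset X
      & [/\ full e [set x] A, full e A B, full e B [set x], occ e p A & occ e q B]]
  end.

Lemma occ_sub e p A B : A \subset B -> occ e p A -> occ e p B.
Proof.
case: p => [|p q|p q] sAB /=.
- by case/set0Pn => x Ax; apply/set0Pn; exists x; apply: (subsetP sAB).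
- move=> [C [D [sC sD fCD oC oD]]]; exists C, D.
  by split=> //; apply: subset_trans sAB.
- move=> [x [C [D [xA sC sD oCD]]]]; exists x, C, D.
  by split=> //; [apply: (subsetP sAB)|apply: subset_trans sAB..].
Qed.

Lemma occ_nonempty e p X : occ e p X -> exists x, x \in X.
Proof.
elim: p X => [|p IHp q IHq|p IHp q IHq] X /=.
- by move/set0Pn.
- by move=> [A [B [sA _ _ /IHp[x Ax] _]]]; exists x; apply: (subsetP sA).
- by move=> [x [A [B [Xx]]]]; exists x.
Qed.

(** Small copies matter because a bounded set is going to be removed around each of their
    vertices. *)
Lemma occ_small e p X : occ e p X ->
  exists Y, [/\ Y \subset X, #|Y| <= psize p & occ e p Y].
Proof.
elim: p X => [|p IHp q IHq|p IHp q IHq] X /=.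
- move=> /set0Pn[x Xx]; exists [set x]; rewrite sub1set Xx cards1; split=> //.
  by apply/set0Pn; exists x; rewrite inE.
- move=> [A [B [sA sB fAB /IHp[A' [sA' cA' oA']] /IHq[B' [sB' cB' oB']]]]].
  exists (A' :|: B'); split.
  + by rewrite subUset (subset_trans sA') ?(subset_trans sB').
  + by apply: leq_trans (leq_add cA' cB'); rewrite cardsU leq_subr.
  + exists A', B'; rewrite subsetUl subsetUr; split=> //.
    exact: full_sub fAB.
- move=> [x [A [B [Xx sA sB [f1 f2 f3 /IHp[A' [sA' cA' oA']]]]]]].
  move=> /IHq[B' [sB' cB' oB']].
  exists (x |: (A' :|: B')); split.
  + by rewrite !subUset (subset_trans sA') ?(subset_trans sB') // sub1set Xx.
  + rewrite cardsU1 -add1n; apply: leq_add; first by case: (_ \notin _).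
    by apply: leq_trans (leq_add cA' cB'); rewrite cardsU leq_subr.
  + exists x, A', B'; rewrite !inE eqxx; split=> //.
    * by rewrite subsetU // subsetUl orbT.
    * by rewrite subsetU // subsetUr orbT.
    * split=> //.
      - exact: full_sub f1.
      - exact: full_sub f2.
      - exact: full_sub f3.
Qed.

Lemma occ_converse e p X : occ e p X -> occ (converse e) (pconv p) X.
Proof.
have fr A B : full e A B -> full (converse e) B A by move=> f x y Bx Ay; apply: f.
elim: p X => [|p IHp q IHq|p IHp q IHq] X //=.
- by move=> [A [B [sA sB /fr ? /IHp ? /IHq ?]]]; exists B, A.
- move=> [x [A [B [Xx sA sB [/fr ? /fr ? /fr ? /IHp ? /IHq ?]]]]].
  by exists x, B, A.
Qed.

(** [TT] grows at its source by definition; this lets it grow at its sink. *)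
Lemma occ_TT_rcons e k A v X : occ e (TT k) A -> full e A [set v] ->
  A \subset X -> v \in X -> occ e (TT k.+1) X.
Proof.
elim: k A X => [|k IH] A X.
  move=> A0 f sA Xv; exists A, [set v]; rewrite sub1set Xv; split=> //.
  by apply/set0Pn; exists v; rewrite inE.
move=> [A1 [A2 [s1 s2 f12 o1 o2]]] f sA Xv.
exists A1, (v |: A2); split=> //.
- exact: subset_trans sA.
- by rewrite subUset sub1set Xv; apply: subset_trans sA.
- move=> x y xA1; rewrite !inE => /orP[/eqP->|yA2]; last exact: f12.
  by apply: f; rewrite ?inE //; apply: (subsetP s1).
- by apply: IH o2 _ _ _; rewrite ?subsetUr ?inE ?eqxx //; apply: full_sub f.
Qed.

End Patterns.

Lemma pconvK : involutive pconv.
Proof. by elim=> //= p -> q ->. Qed.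

Lemma pconv_TT_occ {T : finType} (e : rel T) k X : oriented e ->
  occ e (pconv (TT k)) X -> occ e (TT k) X.
Proof.
move=> oe; elim: k X => [//|k IH] X /= [A [B [sA sB f oA /set0Pn[v Bv]]]].
apply: occ_TT_rcons (IH _ oA) _ sA (subsetP sB _ Bv).
by apply: full_sub f; rewrite // sub1set.
Qed.

(** Around any vertex [v] of a large set, the out-neighbours, the in-neighbours or the
    non-neighbours are numerous. In the first two cases [v] extends a copy of [TT k]; in the third
    the independence bound drops. *)
Lemma oriented_TT a k : exists m, forall (T : finType) (e : rel T) X,
  oriented e -> alpha_lt e a X -> m <= #|X| -> occ e (TT k) X.
Proof.
elim: a k => [|a IHa] k.
  exists 0 => T e X _ /(_ set0); rewrite sub0set cards0 => /(_ isT).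
  by move=> H; have : 0 < 0 by apply: H => x y; rewrite inE.
elim: k => [|k [m IHk]].
  by exists 1 => T e X _ _ /=; rewrite -cards_eq0 -lt0n.
have [m' Hm'] := IHa k.+1.
exists (m + m + m').+1 => T e X oe sX mX.
have /set0Pn[v Xv] : X != set0 by rewrite -cards_eq0 -lt0n; apply: leq_trans mX.
have : #|X| <= #|[set v]| + #|outn e v :&: X| + #|inn e v :&: X| + #|nonn e v :&: X|.
  have sX' : X \subset [set v] :|: outn e v :&: X :|: inn e v :&: X :|: nonn e v :&: X.
    apply/subsetP => w Xw; rewrite !in_setU !in_setI Xw !andbT in_set1.
    by case/or4P: (nbhd_cases e v w) => ->; rewrite ?orbT.
  apply: leq_trans (subset_leq_card sX') _.
  do 3!(apply: leq_trans (leq_card_setU _ _) _; rewrite leq_add2r).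
  by [].
rewrite cards1 => cX.
have [o|o] := leqP m #|outn e v :&: X|.
  exists [set v], (outn e v :&: X); rewrite sub1set Xv subsetIr; split=> //.
  - by move=> x y; rewrite !inE => /eqP-> /andP[].
  - by apply/set0Pn; exists v; rewrite inE.
  - by apply: IHk => //; apply: alpha_lt_sub sX; apply: subsetIr.
have [i|i] := leqP m #|inn e v :&: X|.
  apply: (@occ_TT_rcons _ _ _ (inn e v :&: X) v) => //; last exact: subsetIr.
  - by apply: IHk => //; apply: alpha_lt_sub sX; apply: subsetIr.
  - by move=> x y; rewrite !inE => /andP[+ _] /eqP->.
apply: (@occ_sub _ _ _ (nonn e v :&: X)); first exact: subsetIr.
apply: Hm' => //; first exact: alpha_lt_nonn.
lia.
Qed.

Lemma ramsey a b : exists N, forall (T : finType) (r : rel T) (X : {set T}),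
  symmetric r -> N <= #|X| ->
  (exists Q : {set T}, [/\ Q \subset X, #|Q| = a &
     {in Q &, forall x y, x != y -> r x y}]) \/
  (exists Q : {set T}, [/\ Q \subset X, #|Q| = b &
     {in Q &, forall x y, x != y -> ~~ r x y}]).
Proof.
elim: a b => [|a IHa] b.
  exists 0 => T r X _ _; left; exists set0; rewrite sub0set cards0.
  by split=> // x; rewrite inE.
elim: b => [|b [N1 H1]].
  exists 0 => T r X _ _; right; exists set0; rewrite sub0set cards0.
  by split=> // x; rewrite inE.
have [N2 H2] := IHa b.+1.
exists (N1 + N2).+1 => T r X sr NX.
have /set0Pn[v Xv] : X != set0 by rewrite -cards_eq0 -lt0n; apply: leq_trans NX.
pose X1 := [set x in X :\ v | r v x]; pose X2 := [set x in X :\ v | ~~ r v x].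
have sX1 : X1 \subset X by apply/subsetP => x; rewrite !inE => /andP[/andP[]].
have sX2 : X2 \subset X by apply/subsetP => x; rewrite !inE => /andP[/andP[]].
have cX : #|X| = #|X1| + #|X2| + 1.
  rewrite (cardsD1 v X) Xv addnC; congr (_ + _).
  rewrite -cardsUI [X1 :&: X2](_ : _ = set0) ?cards0 ?addn0.
    apply: eq_card => x; rewrite !inE.
    by case: (x == v); case: (x \in X) => //=; case: (r v x).
  by apply/setP => x; rewrite !inE; case: (r v x); rewrite ?andbF.
have [N2X|N2X] := leqP N2 #|X1|.
  have [[Q [sQ cQ hQ]]|[Q [sQ cQ hQ]]] := H2 T r X1 sr N2X; last first.
    by right; exists Q; split=> //; apply: subset_trans sX1.
  have vQ : v \notin Q by apply/negP => /(subsetP sQ); rewrite !inE eqxx.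
  left; exists (v |: Q); rewrite subUset sub1set Xv (subset_trans sQ) //.
  rewrite cardsU1 vQ cQ; split=> // x y.
  have rQ z : z \in Q -> r v z by move/(subsetP sQ); rewrite !inE => /andP[].
  rewrite !inE => /orP[/eqP->|xQ] /orP[/eqP->|yQ]; rewrite ?eqxx // => xy.
  - exact: rQ.
  - by rewrite sr; apply: rQ.
  - exact: hQ.
have {N2X} N1X : N1 <= #|X2| by lia.
have [[Q [sQ cQ hQ]]|[Q [sQ cQ hQ]]] := H1 T r X2 sr N1X.
  by left; exists Q; split=> //; apply: subset_trans sX2.
have vQ : v \notin Q by apply/negP => /(subsetP sQ); rewrite !inE eqxx.
right; exists (v |: Q); rewrite subUset sub1set Xv (subset_trans sQ) //.
rewrite cardsU1 vQ cQ; split=> // x y.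
have rQ z : z \in Q -> ~~ r v z by move/(subsetP sQ); rewrite !inE => /andP[].
rewrite !inE => /orP[/eqP->|xQ] /orP[/eqP->|yQ]; rewrite ?eqxx // => xy.
- exact: rQ.
- by rewrite sr; apply: rQ.
- exact: hQ.
Qed.

(** * Domination *)

Lemma card_bigcup_leq (I T : finType) k n (P : {set I}) (F : I -> {set T}) :
  #|P| <= k -> {in P, forall i, #|F i| <= n} -> #|\bigcup_(i in P) F i| <= k * n.
Proof.
move=> Pk Fn; apply: (@leq_trans (#|P| * n)); last by rewrite leq_mul2r Pk orbT.
rewrite [#|P|]cardE -big_enum /=.
have : {in enum P, forall i, #|F i| <= n} by move=> i; rewrite mem_enum => /Fn.
elim: (enum P) => [_|i s IH cs]; first by rewrite big_nil cards0.
rewrite big_cons /= mulSn; apply: leq_trans (leq_card_setU _ _) _.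
apply: leq_add; first by apply: cs; rewrite inE eqxx.
by apply: IH => j js; apply: cs; rewrite inE js orbT.
Qed.

Lemma subset_of_card (T : finType) (A : {set T}) n : n <= #|A| ->
  exists S : {set T}, S \subset A /\ #|S| = n.
Proof.
move=> /card_geqP[s [us <- sA]]; exists [set x in s]; split.
  by apply/subsetP => x; rewrite inE => /sA.
by rewrite cardsE; apply/card_uniqP.
Qed.

Lemma pigeonhole_fiber (T : finType) (c : T -> nat) (S : {set T}) k D :
  {in S, forall x, c x < k} -> k * D < #|S| ->
  exists2 q, q < k & D < #|[set x in S | c x == q]|.
Proof.
move=> ck kDS; apply: contrapT => nq.
suff : #|S| <= k * D by rewrite leqNgt kDS.
have sS : S \subset \bigcup_(q in [set: 'I_k]) [set x in S | c x == q].
  apply/subsetP => x Sx; apply/bigcupP.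
  by exists (Ordinal (ck _ Sx)); rewrite !inE // Sx /=.
apply: leq_trans (subset_leq_card sS) _.
apply: card_bigcup_leq; first by rewrite cardsT card_ord.
by move=> q _; rewrite leqNgt; apply/negP => Dq; apply: nq; exists q.
Qed.

Section Domination.
Context {T : finType}.
Implicit Types (e : rel T) (A B D S X Z : {set T}).

Definition closed_outn e D := D :|: \bigcup_(s in D) outn e s.
Definition common_inn e S := [set y | [forall s in S, e y s]].
Definition domby e K X := exists D, [/\ D \subset X, #|D| <= K & X \subset closed_outn e D].

Lemma common_innP e S y : reflect {in S, forall s, e y s} (y \in common_inn e S).
Proof. by rewrite inE; apply: (iffP forall_inP). Qed.

Lemma closed_outnP e D z : reflect (z \in D \/ exists2 s, s \in D & e s z) (z \in closed_outn e D).
Proof.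
rewrite !inE; apply: (iffP orP) => -[zD|]; [by left| |by left|].
  by move=> /bigcupP[s Ds]; rewrite inE => sz; right; exists s.
by move=> [s Ds sz]; right; apply/bigcupP; exists s; rewrite ?inE.
Qed.

Lemma closed_outn_sub e A B : A \subset B -> closed_outn e A \subset closed_outn e B.
Proof.
move=> sAB; apply/subsetP => z /closed_outnP[zA|[s As sz]]; apply/closed_outnP.
  by left; apply: (subsetP sAB).
by right; exists s => //; apply: (subsetP sAB).
Qed.

(** A vertex of [Z] that is not dominated by [S] and does not dominate all of [S] is a non-neighbour
    of some [v] in [S], so the set dominating [nonn e v :&: X] reaches it. *)
Lemma dominate_rest e n K' Kr S X Z : S \subset X -> Z \subset X -> #|S| <= n ->
  {in S, forall v, domby e K' (nonn e v :&: X)} -> domby e Kr (Z :&: common_inn e S) ->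
  exists D, [/\ D \subset X, #|D| <= n + n * K' + Kr & Z \subset closed_outn e D].
Proof.
move=> sS sZ Sn dS [Dr [sDr cDr dZ]].
have /choice[F HF] : forall v, exists D : {set T}, v \in S ->
    [/\ D \subset nonn e v :&: X, #|D| <= K' & nonn e v :&: X \subset closed_outn e D].
  move=> v; have [/dS[D HD]|_] := boolP (v \in S); first by exists D.
  by exists set0.
exists (S :|: \bigcup_(v in S) F v :|: Dr); split.
- rewrite !subUset sS /=; apply/andP; split.
    apply/bigcupsP => v Sv; have [sF _ _] := HF _ Sv.
    by apply: subset_trans sF _; apply: subsetIr.
  by apply: subset_trans sDr _; apply: subset_trans sZ; apply: subsetIl.
- apply: leq_trans (leq_card_setU _ _) _; apply: leq_add => //.
  apply: leq_trans (leq_card_setU _ _) _; apply: leq_add => //.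
  by apply: card_bigcup_leq => // v Sv; have [_ ->] := HF _ Sv.
apply/subsetP => z Zz.
have [zS|zS] := boolP (z \in closed_outn e S).
  by apply: (subsetP (closed_outn_sub _ _)) zS; rewrite -setUA subsetUl.
have [zc|zc] := boolP (z \in common_inn e S).
  have /(subsetP dZ) : z \in Z :&: common_inn e S by rewrite in_setI Zz.
  by apply: (subsetP (closed_outn_sub _ _)); rewrite subsetUr.
have [v Sv nzv] : exists2 v, v \in S & ~~ e z v.
  by move: zc; rewrite inE negb_forall => /existsP[v]; rewrite negb_imply => /andP[]; exists v.
have [sF _ /subsetP/(_ z) zF] := HF _ Sv.
apply: (subsetP (closed_outn_sub _ _)) (zF _).
  by rewrite -setUA setUCA subsetU // (bigcup_sup v).
rewrite !inE nzv (subsetP sZ) // !andbT; apply/andP; split.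
  by apply: contraNneq zS => ->; apply/closed_outnP; left.
by apply: contraNN zS => vz; apply/closed_outnP; right; exists v.
Qed.

Lemma min_dominating e X : exists B, [/\ B \subset X, X \subset closed_outn e B &
  forall D, D \subset X -> X \subset closed_outn e D -> #|B| <= #|D|].
Proof.
pose P D := (D \subset X) && (X \subset closed_outn e D).
have PX : P X by rewrite /P subxx subsetUl.
case: (arg_minnP (fun D : {set T} => #|D|) PX) => B /andP[sB dB] minB.
by exists B; split=> // D sD dD; apply: minB; rewrite /P sD.
Qed.

End Domination.

Lemma not_alpha_lt0 (T : finType) (e : rel T) X : ~ alpha_lt e 0 X.
Proof.
move=> /(_ set0); rewrite sub0set cards0 => H.
by have : 0 < 0 by apply: H => // x y; rewrite inE.
Qed.

Lemma jewel0 (T : finType) (e : rel T) X : X != set0 -> jewel e 0 1 X.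
Proof.
case/set0Pn => x Xx; exists [set x]; rewrite sub1set Xx cards1; split=> //.
by move/col0/setP/(_ x); rewrite !inE eqxx.
Qed.

(* Take [S] inside a minimum dominating set, a jewel [S'] with [S' => S], and for each large
   [W] included in [S] a jewel inside [N+[W]] all of whose vertices dominate [S']; the latter
   exists because minimality makes [N+[W]] hard to dominate. If [W] is a colour class of [S],
   its colour occurs in [S'] and in the jewel of [W], which gives a triangle. *)
Theorem dominated_or_jewel a r : exists K N, forall (T : finType) (e : rel T) X,
  oriented e -> alpha_lt e a X -> domby e K X \/ jewel e r N X.
Proof.
elim: a r => [|a IHa] r; first by exists 0, 0 => T e X _ /not_alpha_lt0.
elim: r => [|r [Kr [Nr IHr]]].
  exists 0, 1 => T e X _ _; have [->|/jewel0] := eqVneq X set0; last by right.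
  by left; exists set0; rewrite !sub0set cards0.
have [K' [N' IH']] := IHa r.+1.
(* [D0] is the bound of [dominate_rest] for a set of at most [Nr] vertices; [r.+1] colours on [s]
   vertices put more than [D0] of them into one class. *)
pose D0 := Nr + Nr * K' + Kr; pose s := (r.+1 * D0).+1.
pose N := s + Nr + 2 ^ s * Nr.
exists (s + s * K' + Kr + s), (N + N') => T e X oe sX.
apply: contrapT => /not_orP[ndX njX].
have dn v : v \in X -> domby e K' (nonn e v :&: X).
  move=> Xv; have [//|[J [sJ cJ nJ]]] := IH' T e (nonn e v :&: X) oe (alpha_lt_nonn oe Xv sX).
  case: njX; exists J; split=> //; first by apply: subset_trans sJ (subsetIr _ _).
  by apply: leq_trans cJ _; apply: leq_addl.
have [B [sB dB minB]] := min_dominating e X.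
have Bs : s <= #|B|.
  rewrite leqNgt; apply/negP => Bs; apply: ndX; exists B; split=> //; lia.
have [S [sS cS]] := subset_of_card Bs.
have sSX := subset_trans sS sB.
have stY (Y : {set T}) : Y \subset X -> alpha_lt e a.+1 Y by move=> sY; apply: alpha_lt_sub sX.
have [dY|[S' [sS' cS' nS']]] := IHr T e (X :&: common_inn e S) oe (stY _ (subsetIl _ _)).
  have dnS : {in S, forall v, domby e K' (nonn e v :&: X)}.
    by move=> v /(subsetP sSX)/dn.
  have [D [sD cD dD]] := dominate_rest sSX (subxx X) (eq_leq cS) dnS dY.
  by case: ndX; exists D; split=> //; lia.
have sS'X : S' \subset X by apply: subset_trans sS' (subsetIl _ _).
have full1 x v : x \in S' -> v \in S -> e x v.
  by move=> /(subsetP sS'); rewrite in_setI => /andP[_ /common_innP]; apply.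
(* If this set were dominated by [Kr] vertices, at most [D0] vertices would dominate
   [X :&: closed_outn e W]; exchanging [W] for them in [B] would contradict the minimality of
   [B]. *)
have jW (W : {set T}) : W \subset S -> D0 < #|W| ->
    jewel e r Nr (X :&: closed_outn e W :&: common_inn e S').
  move=> sW cW.
  have [|dY|//] := IHr T e (X :&: closed_outn e W :&: common_inn e S') oe.
    by apply: stY; rewrite -setIA subsetIl.
  have dnS' : {in S', forall v, domby e K' (nonn e v :&: X)}.
    by move=> v /(subsetP sS'X)/dn.
  have [D [sD cD dD]] := dominate_rest sS'X (subsetIl X (closed_outn e W)) cS' dnS' dY.
  have sWB := subset_trans sW sS.
  have := minB ((B :\: W) :|: D).
  have : #|B :\: W :|: D| <= #|B :\: W| + #|D| := leq_card_setU _ _.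
  rewrite cardsD (setIidPr sWB); have := subset_leq_card sWB.
  move=> cWB cBWD mB; suff : #|B| <= #|B :\: W :|: D| by lia.
  apply: mB.
    by rewrite subUset sD andbT; apply: subset_trans sB; apply: subsetDl.
  apply/subsetP => z Xz.
  have [zW|zW] := boolP (z \in closed_outn e W).
    have /(subsetP dD) : z \in X :&: closed_outn e W by rewrite in_setI Xz.
    by apply: (subsetP (closed_outn_sub _ _)); apply: subsetUr.
  apply: (subsetP (closed_outn_sub _ (subsetUl _ _))).
  have /closed_outnP[zB|[b Bb bz]] := subsetP dB _ Xz; apply/closed_outnP.
    left; rewrite inE zB andbT; apply: contraNN zW => zW; apply/closed_outnP; by left.
  right; exists b => //; rewrite inE Bb andbT.
  by apply: contraNN zW => bW; apply/closed_outnP; right; exists b.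
have /choice[F HF] : forall W : {set T}, exists D : {set T}, #|D| <= Nr /\
    (W \subset S -> D0 < #|W| ->
     D \subset X :&: closed_outn e W :&: common_inn e S' /\ ~ col e r D).
  move=> W.
  have [/jW jW'|nW] := pselect (W \subset S); last by exists set0; rewrite cards0; split.
  have [/jW'[J [sJ cJ nJ]]|nW] := pselect (D0 < #|W|); last first.
    by exists set0; rewrite cards0; split.
  by exists J; split.
pose Ws := [set W in powerset S | D0 < #|W|].
have WsP W : W \in Ws -> W \subset S /\ D0 < #|W|.
  by rewrite !inE => /andP[].
apply: njX; exists (S :|: S' :|: \bigcup_(W in Ws) F W); split.
- rewrite !subUset sSX sS'X /=; apply/bigcupsP => W /WsP[sW cW].
  have [_ /(_ sW cW)[sF _]] := HF W.
  by apply: subset_trans sF _; rewrite -setIA subsetIl.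
- apply: leq_trans (leq_card_setU _ _) _.
  apply: (@leq_trans N); last exact: leq_addr.
  apply: leq_add.
    by apply: leq_trans (leq_card_setU _ _) _; rewrite cS leq_add2l.
  apply: card_bigcup_leq => [|W _]; last by have [] := HF W.
  rewrite -cS -card_powerset; apply: subset_leq_card; apply/subsetP => W.
  by rewrite inE => /andP[].
move=> [c cr ac].
have [q qr cq] : exists2 q, q < r.+1 & D0 < #|[set x in S | c x == q]|.
  by apply: pigeonhole_fiber; [move=> x Sx; apply: cr; rewrite !inE Sx|rewrite cS].
set W := [set _ in S | _] in cq.
have sW : W \subset S by apply/subsetP => x; rewrite inE => /andP[].
have WWs : W \in Ws by rewrite !inE sW.
have [_ /(_ sW cq)[sF nF]] := HF W.
have [x xS' cx] : exists2 x, x \in S' & c x = q.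
  apply: (col_all_colors nS') => // [x xS'|i]; first by apply: cr; rewrite !inE xS' orbT.
  apply: acy_sub (ac i); apply/subsetP => x; rewrite !inE => /andP[-> ->].
  by rewrite orbT.
have FJ y : y \in F W -> y \in \bigcup_(W in Ws) F W.
  by move=> Fy; apply/bigcupP; exists W.
have [y yF cy] : exists2 y, y \in F W & c y = q.
  apply: (col_all_colors nF) => // [y yF|i].
    by apply: cr; rewrite in_setU FJ // orbT.
  apply: acy_sub (ac i); apply/subsetP => y; rewrite !inE => /andP[/FJ yF ->].
  by rewrite yF orbT.
have /andP[/andP[Xy /closed_outnP yW] /common_innP yS'] : (y \in X) && (y \in closed_outn e W) && (y \in common_inn e S').
  by have := subsetP sF _ yF; rewrite !in_setI.
case: yW => [yW|[w wW wy]].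
  by have := full1 x y xS' (subsetP sW _ yW); move/oe; rewrite yS'.
move: (wW); rewrite inE => /andP[wS /eqP cw].
apply: (acy_tri (ac q) (x := x) (y := w) (z := y)).
- by rewrite !inE xS' cx eqxx orbT.
- by rewrite !inE wS cw eqxx.
- by rewrite inE in_setU FJ // cy eqxx orbT.
- exact: full1.
- exact: wy.
- exact: yS'.
Qed.

(** If a bounded set dominates [X], its out-neighbourhoods colour [X]. Otherwise there is a jewel
    [J] that is not [K + c0]-colourable. It dominates [X] too: a vertex outside [J] without
    in-neighbour in [J] would split [J] into out-neighbours and non-neighbours, which need only
    [K + c0] colours. *)
Theorem local_to_global a K c0 : exists f, forall (T : finType) (e : rel T) X,
  oriented e -> alpha_lt e a X -> {in X, forall v, col e K (outn e v :&: X)} ->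
  {in X, forall v, col e c0 (nonn e v :&: X)} -> col e f X.
Proof.
have [Kd [N H]] := dominated_or_jewel a (K + c0).
exists ((Kd + N) * K.+1) => T e X oe sX cO cN.
have dom_col (D : {set T}) : D \subset X -> #|D| <= Kd + N -> X \subset closed_outn e D ->
    col e ((Kd + N) * K.+1) X.
  move=> sD cD dD; apply: (@col_bigcup _ _ _ _ _ D (fun v => v |: outn e v :&: X)) => //.
    apply/subsetP => z Xz; apply/bigcupP.
    have /closed_outnP[zD|[v Dv vz]] := subsetP dD _ Xz.
      by exists z; rewrite // !inE eqxx.
    by exists v; rewrite // !inE vz Xz orbT.
  move=> v Dv; rewrite -addn1 addnC; apply: colU; first exact: col1.
  by apply: cO; apply: (subsetP sD).
have [[D [sD cD dD]]|[J [sJ cJ nJ]]] := H T e X oe sX.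
  by apply: dom_col sD _ dD; apply: leq_trans cD (leq_addr _ _).
apply: (dom_col _ sJ); first by apply: leq_trans cJ (leq_addl _ _).
apply/subsetP => z Xz; apply/closed_outnP; have [zJ|zJ] := boolP (z \in J); first by left.
right; apply: contrapT => nz; apply: nJ.
apply: col_cover2 (cO z Xz) (cN z Xz) _ (leqnn _).
apply/subsetP => w Jw; rewrite in_setU !in_setI (subsetP sJ) // !andbT.
case/or4P: (nbhd_cases e z w) => [/eqP wz|->|zw|->]; rewrite ?orbT //.
  by move: zJ; rewrite -wz Jw.
by case: nz; exists w => //; move: zw; rewrite inE.
Qed.

(** * Light arcs, jewels and ordered sums *)

Definition h_nbhd (T : finType) (h : rel T) v := [set w | h v w & w != v].

(* The relation [h] collects the pairs that are nonadjacent or joined by a heavy arc. *)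
Definition light (T : finType) (e h : rel T) b (X : {set T}) :=
  {in X &, forall u v, u != v -> ~~ h u v -> e u v || e v u} /\
  {in X &, forall u v, e u v -> ~~ h u v ->
     col e b (outn e v :&: inn e u :&: X)}.

Definition clique_lt (T : finType) (h : rel T) s (X : {set T}) :=
  forall Q : {set T}, Q \subset X -> {in Q &, forall x y, x != y -> h x y} -> #|Q| < s.

Definition superhero p a := exists m, forall (T : finType) (e : rel T) X,
  oriented e -> alpha_lt e a X -> ~ occ e p X -> col e m X.

(** A stepping stone: it implies [has_jewels], and the jewels are then used to prove [superhero]. *)
Definition light_bounded p a := forall b s, exists f,
  forall (T : finType) (e h : rel T) X,
  oriented e -> alpha_lt e a X -> ~ occ e p X ->
  symmetric h -> clique_lt h s X -> light e h b X -> col e f X.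

Definition has_jewels p a := forall r, exists b N,
  forall (T : finType) (e : rel T) X,
  oriented e -> alpha_lt e a X -> ~ occ e p X -> col e b X \/ jewel e r N X.

Lemma light_sub (T : finType) (e h : rel T) b (A B : {set T}) : A \subset B ->
  light e h b B -> light e h b A.
Proof.
move=> sAB [l1 l2]; split=> u v /(subsetP sAB) Bu /(subsetP sAB) Bv; first exact: l1.
by move=> uv huv; apply: col_sub (l2 u v Bu Bv uv huv); apply: setIS.
Qed.

Lemma nonn_sub_h_nbhd (T : finType) (e h : rel T) b (X : {set T}) v : v \in X ->
  light e h b X -> nonn e v :&: X \subset h_nbhd h v :&: X.
Proof.
move=> Xv [l1 _]; apply/subsetP => w.
rewrite !inE => /andP[/and3P[wv vw wv'] Xw]; rewrite wv Xw !andbT.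
apply: contraT => hvw; have := l1 v w Xv Xw; rewrite eq_sym wv (negPf vw) (negPf wv').
by move=> /(_ isT hvw).
Qed.

Lemma clique_lt_nbhd (T : finType) (h : rel T) s (X : {set T}) v :
  symmetric h -> v \in X -> clique_lt h s.+1 X ->
  clique_lt h s (h_nbhd h v :&: X).
Proof.
move=> sh Xv lX Q sQ hQ.
have vQ : v \notin Q by apply/negP => /(subsetP sQ); rewrite !inE eqxx andbF.
have := lX (v |: Q); rewrite cardsU1 vQ; apply.
  apply/subsetP => x; rewrite !inE => /orP[/eqP->//|/(subsetP sQ)].
  by rewrite !inE => /andP[].
have hv x : x \in Q -> h v x.
  by move=> /(subsetP sQ); rewrite !inE => /andP[/andP[]].
move=> x y; rewrite !inE => /orP[/eqP->|xQ] /orP[/eqP->|yQ]; last exact: hQ.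
- by rewrite eqxx.
- by move=> _; apply: hv.
- by move=> _; rewrite sh; apply: hv.
Qed.

(* Bounded-size sets of large dichromatic number ("mountains"): r + 2 vertices whose
   arcs [u -> v] all have an r-chromatic set in [N+(v) :&: N-(u)] cannot be coloured
   with r + 1 colours, since two of them and a vertex of that set would form a
   monochromatic triangle. *)
Lemma light_bounded_jewels p a : light_bounded p a -> has_jewels p a.
Proof.
move=> Lp; elim=> [|r [b [N IH]]].
  exists 0, 1 => T e X _ _ _; have [->|/jewel0] := eqVneq X set0; last by right.
  by left; apply: col_set0.
have [s Hs] := ramsey a r.+2.
have [f Hf] := Lp b s.
exists f, (r.+2 + r.+2 * r.+2 * N) => T e X oe sX nX.
(* An arc is heavy if the vertices closing a triangle with it contain a jewel. By induction the
   other arcs are light with bound [b]. *)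
pose heavy u v := `[< e u v /\ jewel e r N (outn e v :&: inn e u :&: X) >].
pose adj u v := e u v || e v u.
pose h u v := [|| ~~ adj u v, heavy u v | heavy v u].
have sadj : symmetric adj by move=> u v; rewrite /adj orbC.
have sh : symmetric h by move=> u v; rewrite /h sadj [heavy u v || _]orbC.
have lh : light e h b X.
  split=> u v Xu Xv; first by rewrite /h negb_or negbK => _ /andP[].
  move=> uv /norP[_ /norP[/negP nj _]].
  have [||//|j] := IH T e (outn e v :&: inn e u :&: X) oe.
  - by apply: alpha_lt_sub sX; apply: subsetIr.
  - by move=> oX; apply: nX; apply: occ_sub oX; apply: subsetIr.
  - by case: nj; apply/asboolP; split.
have [cl|ncl] := pselect (clique_lt h s X).
  by left; apply: (Hf T e h X oe sX nX sh cl lh).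
right.
have [Q0 [sQ0 hQ0 cQ0]] : exists Q : {set T}, [/\ Q \subset X,
    {in Q &, forall x y, x != y -> h x y} & s <= #|Q|].
  apply: contrapT => nQ; apply: ncl => Q sQ hQ; rewrite ltnNge; apply/negP => sQ'.
  by apply: nQ; exists Q.
have snadj : symmetric (fun u v => ~~ adj u v) by move=> u v; rewrite sadj.
(* A large [h]-clique has [a] independent vertices, which is excluded, or [r.+2] vertices joined
   pairwise by arcs, all of them heavy. *)
have [[Q [sQ cQ hQ]]|[Q [sQ cQ hQ]]] := Hs T _ Q0 snadj cQ0.
  have := sX Q (subset_trans sQ sQ0); rewrite cQ ltnn => H.
  suff : false by []; apply: H => x y Qx Qy; have [->|xy] := eqVneq x y.
    by rewrite oriented_irr.
  by have := hQ x y Qx Qy xy; rewrite negb_or => /andP[].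
have sQX := subset_trans sQ sQ0.
have hvQ u v : u \in Q -> v \in Q -> e u v -> heavy u v.
  move=> Qu Qv uv; have uv' : u != v by apply: contraTneq uv => ->; rewrite oriented_irr.
  have := hQ0 u v (subsetP sQ _ Qu) (subsetP sQ _ Qv) uv'.
  case/or3P=> // [|/asboolP[vu _]]; last by have := oe _ _ vu; rewrite uv.
  by rewrite /adj uv.
have /choice[F HF] : forall uv : T * T, exists D : {set T}, #|D| <= N /\
   (uv.1 \in Q -> uv.2 \in Q -> e uv.1 uv.2 ->
     D \subset outn e uv.2 :&: inn e uv.1 :&: X /\ ~ col e r D).
  move=> [u v] /=.
  have [[[Qu Qv] uv]|n] := pselect ((u \in Q /\ v \in Q) /\ e u v).
    by have /asboolP[_ [J [sJ cJ nJ]]] := hvQ u v Qu Qv uv; exists J.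
  by exists set0; rewrite cards0; split=> // Qu Qv uv; case: n.
pose Ps := [set uv in setX Q Q | e uv.1 uv.2].
have PsP uv : uv \in Ps -> [/\ uv.1 \in Q, uv.2 \in Q & e uv.1 uv.2].
  by rewrite !inE => /andP[/andP[]].
exists (Q :|: \bigcup_(uv in Ps) F uv); split.
- rewrite subUset sQX; apply/bigcupsP => uv /PsP[Qu Qv uvE].
  have [_ /(_ Qu Qv uvE)[sF _]] := HF uv.
  by apply: subset_trans sF _; apply: subsetIr.
- apply: leq_trans (leq_card_setU _ _) _; rewrite cQ leq_add2l.
  apply: card_bigcup_leq => [|uv _]; last by have [] := HF uv.
  rewrite -cQ -cardsX; apply: subset_leq_card; apply/subsetP => uv.
  by rewrite inE => /andP[].
move=> [c cr ac].
have [q qr cq] : exists2 q, q < r.+1 & 1 < #|[set x in Q | c x == q]|.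
  apply: pigeonhole_fiber; last by rewrite cQ muln1.
  by move=> x Qx; apply: cr; rewrite !inE Qx.
have [u [v [uQ vQ uv]]] : exists u v, [/\ u \in [set x in Q | c x == q],
    v \in [set x in Q | c x == q] & e u v].
  have /card_gt1P[u [v [uQ vQ uv]]] := cq.
  move: (uQ) (vQ); rewrite !inE => /andP[Qu _] /andP[Qv _].
  have := hQ u v Qu Qv uv; rewrite negbK => /orP[] uvE; first by exists u, v.
  by exists v, u.
move: uQ vQ; rewrite !inE => /andP[Qu /eqP cu] /andP[Qv /eqP cv].
have PsI : (u, v) \in Ps by rewrite !inE Qu Qv.
have [_ /(_ Qu Qv uv)[/= sF nF]] := HF (u, v).
have FJ y : y \in F (u, v) -> y \in \bigcup_(uv in Ps) F uv.
  by move=> Fy; apply/bigcupP; exists (u, v).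
have [y yF cy] : exists2 y, y \in F (u, v) & c y = q.
  apply: (col_all_colors nF) => // [y yF|i].
    by apply: cr; rewrite in_setU FJ // orbT.
  apply: acy_sub (ac i); apply/subsetP => y; rewrite !inE => /andP[/FJ yF ->].
  by rewrite yF orbT.
have := subsetP sF _ yF; rewrite !inE => /andP[/andP[vy yu] _].
apply: (acy_tri (ac q) (x := u) (y := v) (z := y)) => //.
- by rewrite !inE Qu cu eqxx.
- by rewrite !inE Qv cv eqxx.
- by rewrite inE in_setU FJ // cy eqxx orbT.
Qed.

(** * Ordered sums *)

Section SeqBounded.
Context {T : finType}.
Implicit Types (e h : rel T) (X A B : {set T}).

Lemma seq_occ e p q A B X : A \subset X -> B \subset X -> full e A B ->
  occ e p A -> occ e q B -> occ e (Seq p q) X.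
Proof. by move=> sA sB f oA oB; exists A, B. Qed.

(** Take a small copy [Y] of [q]. Out-neighbours and non-neighbours of its vertices are bounded, so
    the vertices dominating all of [Y] still have large dichromatic number and contain [p]. *)
Lemma bounded_out_seq e p q c c1 K X : oriented e -> ~ occ e (Seq p q) X ->
  (forall Y : {set T}, Y \subset X -> ~ occ e p Y -> col e c Y) ->
  (forall Y : {set T}, Y \subset X -> ~ occ e q Y -> col e c Y) ->
  {in X, forall v, col e c1 (nonn e v :&: X)} ->
  {in X, forall v, col e K (outn e v :&: X)} ->
  col e (psize q * (K + c1).+1 + c) X.
Proof.
move=> oe nX Hp Hq cn cK; apply: contrapT => ncX.
have /occ_small[Y [sY cY oY]] : occ e q X.
  by apply: contrapT => /(Hq _ (subxx X)) /col_leq cX; apply: ncX; apply: cX; lia.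
pose F v := v |: (outn e v :&: X :|: nonn e v :&: X).
have cF : {in Y, forall v, col e (K + c1).+1 (F v)}.
  move=> v /(subsetP sY) Xv; rewrite -addn1 addnC; apply: colU; first exact: col1.
  by apply: colU; [apply: cK|apply: cn].
have := col_rem cY cF ncX; set Z := _ :\: _ => nZ.
have sZ : Z \subset X by apply: subsetDl.
have oZ : occ e p Z by apply: contrapT => /(Hp _ sZ).
apply: nX; apply: (seq_occ sZ sY) => // z y Zz Yy.
move: Zz; rewrite inE => /andP[/bigcupP zF Xz].
have := nbhd_cases e y z => /or4P[/eqP zy|yz|zy|yz].
- by case: zF; exists y; rewrite // !inE zy eqxx.
- by case: zF; exists y; rewrite // !inE Xz; move: yz; rewrite inE => ->; rewrite orbT.
- by move: zy; rewrite inE.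
- by case: zF; exists y; rewrite // in_setU1 in_setU !in_setI Xz yz !orbT.
Qed.

End SeqBounded.

(** Induction on [s] bounds the [h]-neighbourhoods. Then each vertex [v] has a bounded in- or
    out-neighbourhood: otherwise take a small copy [P] of [p] among its light in-neighbours; as the
    arcs from [P] to [v] are light, few out-neighbours of [v] send arcs back to [P], and the others
    contain [q]. The two classes of vertices are coloured by [bounded_out_seq], applied to [e] and
    to its converse. *)
Lemma seq_light_bounded p q a : superhero p a -> superhero q a ->
  light_bounded (Seq p q) a.
Proof.
move=> [cp Hp] [cq Hq] b; elim=> [|s [c1 IH]].
  exists 0 => T e h X _ _ _ _ /(_ set0); rewrite sub0set cards0 => H.
  by have : 0 < 0 by apply: H => // x; rewrite inE.
pose c := cp + cq.
pose K := psize p * (b + c1) + c + c1.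
exists (psize q * (K + c1).+1 + c + (psize p * (K + c1).+1 + c)).
move=> T e h X oe sX nX sh cl lh; have [l1 l2] := lh.
have Hp' (Y : {set T}) : Y \subset X -> ~ occ e p Y -> col e c Y.
  move=> sY nY; apply: (@col_leq _ _ cp); first exact: leq_addr.
  by apply: Hp => //; apply: alpha_lt_sub sX.
have Hq' (Y : {set T}) : Y \subset X -> ~ occ e q Y -> col e c Y.
  move=> sY nY; apply: (@col_leq _ _ cq); first exact: leq_addl.
  by apply: Hq => //; apply: alpha_lt_sub sX.
have nY (Y : {set T}) : Y \subset X -> ~ occ e (Seq p q) Y.
  by move=> sY oY; apply: nX; apply: occ_sub oY.
have chn : {in X, forall v, col e c1 (h_nbhd h v :&: X)}.
  move=> v Xv; have sV : h_nbhd h v :&: X \subset X by apply: subsetIr.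
  apply: (IH T e h _ oe (alpha_lt_sub sV sX) (nY _ sV) sh).
    exact: clique_lt_nbhd.
  exact: light_sub sV lh.
have cnon : {in X, forall v, col e c1 (nonn e v :&: X)}.
  by move=> v Xv; apply: col_sub (chn v Xv); apply: nonn_sub_h_nbhd lh.
have sides v : v \in X -> col e K (outn e v :&: X) \/ col e K (inn e v :&: X).
  move=> Xv; pose B := (inn e v :\: h_nbhd h v) :&: X; pose A := (outn e v :\: h_nbhd h v) :&: X.
  have sB : B \subset X by apply: subsetIr.
  have sA : A \subset X by apply: subsetIr.
  have [cB|nB] := pselect (col e c B).
    right; apply: col_cover2 cB (chn v Xv) _ _; last by rewrite /K; lia.
    by apply/subsetP => w; rewrite !inE; case: (h v w && _) => /=; case: (e w v) => //= ->.
  have [cA|nA] := pselect (col e (psize p * (b + c1) + c) A).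
    left; apply: col_cover2 cA (chn v Xv) _ _; last by rewrite /K; lia.
    by apply/subsetP => w; rewrite !inE; case: (h v w && _) => /=; case: (e v w) => //= ->.
  have /occ_small[P [sP cP oP]] : occ e p B by apply: contrapT => /(Hp' _ sB).
  pose F u := outn e v :&: inn e u :&: X :|: h_nbhd h u :&: X.
  have PX u : u \in P -> [/\ u \in X, e u v & ~~ h u v].
    move=> /(subsetP sP); rewrite !inE => /andP[/andP[nh uv] Xu]; split=> //.
    have uv' : u != v by apply: contraTneq uv => ->; rewrite oriented_irr.
    by move: nh; rewrite uv' andbT sh.
  have cF : {in P, forall u, col e (b + c1) (F u)}.
    move=> u /PX[Xu uv nh]; apply: colU; last exact: chn.
    exact: l2.
  have := col_rem cP cF nA; set Z := _ :\: _ => nZ.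
  have sZA : Z \subset A by apply: subsetDl.
  have sZ := subset_trans sZA sA.
  have oZ : occ e q Z by apply: contrapT => /(Hq' _ sZ).
  case: nX; apply: (seq_occ (subset_trans sP sB) sZ) => // u w Pu Zw.
  have [Xu uv nh] := PX _ Pu.
  have Xw := subsetP sZ _ Zw.
  have vw : e v w by have := subsetP sZA _ Zw; rewrite !inE => /andP[/andP[]].
  have wu : w != u by apply: contraTneq vw => ->; apply: oe.
  have nF : w \notin F u.
    by move: Zw; rewrite inE => /andP[+ _]; apply: contraNN => wF; apply/bigcupP; exists u.
  have : e u w || e w u.
    apply: l1 => //; first by rewrite eq_sym.
    by apply: contraNN nF => huw; rewrite !inE huw wu Xw orbT.
  by case/orP=> // ewu; move: nF; rewrite !inE vw ewu Xw.
pose R := [set v in X | `[< col e K (outn e v :&: X) >]].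
pose L := [set v in X | `[< col e K (inn e v :&: X) >]].
have sR : R \subset X by apply/subsetP => v; rewrite inE => /andP[].
have sL : L \subset X by apply/subsetP => v; rewrite inE => /andP[].
have subY (Y Z : {set T}) : Y \subset X -> Z \subset Y -> Z \subset X.
  by move=> sY sZ; apply: subset_trans sY.
apply: (@col_cover2 _ _ (psize q * (K + c1).+1 + c) (psize p * (K + c1).+1 + c) _ R L) => //.
- apply: (@bounded_out_seq _ e p q) => //.
  + exact: nY.
  + by move=> Y sY; apply: Hp'; apply: subY sY.
  + by move=> Y sY; apply: Hq'; apply: subY sY.
  + by move=> v /(subsetP sR)/cnon; apply: col_sub; apply: setIS.
  + by move=> v; rewrite inE => /andP[_ /asboolP]; apply: col_sub; apply: setIS.
- apply/col_converse.
  have -> : psize p = psize (pconv p) by elim: (p) => //= p1 -> p2 ->; rewrite addnC.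
  apply: (@bounded_out_seq _ (converse e) (pconv q) (pconv p)).
  + exact: oriented_converse.
  + move=> /occ_converse /=; rewrite !pconvK; apply: nY.
    exact: sL.
  + move=> Y sY nqY; apply/col_converse; apply: Hq'; first exact: subY sY.
    by move=> oY; apply: nqY; apply: occ_converse.
  + move=> Y sY npY; apply/col_converse; apply: Hp'; first exact: subY sY.
    by move=> oY; apply: npY; apply: occ_converse.
  + move=> v /(subsetP sL)/cnon cv; rewrite nonn_converse; apply/col_converse.
    by apply: col_sub cv; apply: setIS.
  + move=> v; rewrite inE => /andP[_ /asboolP cv]; apply/col_converse.
    by apply: col_sub cv; apply: setIS.
- apply/subsetP => v Xv; rewrite in_setU !inE Xv /=.
  by have [/asboolP->|/asboolP->] := sides v Xv; rewrite ?orbT.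
Qed.

(** A vertex outside the jewel [J] has a copy of [q] among its out-neighbours in [J] or of [p] among
    its in-neighbours there, for otherwise [J] would be [cq + cp + c0]-colourable. The vertices
    dominating a given copy of [q] contain no [p], those dominated by a given copy of [p] contain no
    [q], and [J] has at most [2 ^ N] subsets. *)
Theorem seq_superhero p q : (forall a, superhero p a) -> (forall a, superhero q a) ->
  forall a, superhero (Seq p q) a.
Proof.
move=> Hp Hq; elim=> [|a [c0 H0]]; first by exists 0 => T e X _ /not_alpha_lt0.
have [cp Hcp] := Hp a.+1; have [cq Hcq] := Hq a.+1.
have [b [N HJ]] := light_bounded_jewels (seq_light_bounded (Hp a.+1) (Hq a.+1)) (cq + cp + c0).
exists (b + (N + (2 ^ N * cq + 2 ^ N * cp))) => T e X oe sX nX.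
have [cX|[J [sJ cJ nJ]]] := HJ T e X oe sX nX.
  by apply: col_leq cX; apply: leq_addr.
apply: (@col_leq _ _ (N + (2 ^ N * cq + 2 ^ N * cp))); first exact: leq_addl.
pose Wp := [set W in powerset J | `[< occ e p W >]].
pose Wq := [set W in powerset J | `[< occ e q W >]].
have cpow (W : {set {set T}}) : W \subset powerset J -> #|W| <= 2 ^ N.
  move=> sW; apply: leq_trans (subset_leq_card sW) _.
  by rewrite card_powerset leq_exp2l.
have sW1 : Wp \subset powerset J by apply/subsetP => W; rewrite inE => /andP[].
have sW2 : Wq \subset powerset J by apply/subsetP => W; rewrite inE => /andP[].
apply: (@col_cover2 _ _ N (2 ^ N * cq + 2 ^ N * cp) _ J
  (\bigcup_(W in Wp) (X :&: common_inn (converse e) W) :|: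
   \bigcup_(W in Wq) (X :&: common_inn e W))) => //.
- exact: col_card.
- apply: colU.
  + apply: (col_bigcup (subxx _) (cpow _ sW1)) => W.
    rewrite inE powersetE => /andP[sW /asboolP oW].
    apply: Hcq => //; first by apply: alpha_lt_sub sX; apply: subsetIl.
    move=> oX; apply: nX; apply: (seq_occ (subset_trans sW sJ) (subsetIl _ _) _ oW oX).
    by move=> x y Wx; rewrite in_setI => /andP[_ /common_innP]; apply.
  + apply: (col_bigcup (subxx _) (cpow _ sW2)) => W.
    rewrite inE powersetE => /andP[sW /asboolP oW].
    apply: Hcp => //; first by apply: alpha_lt_sub sX; apply: subsetIl.
    move=> oX; apply: nX; apply: (seq_occ (subsetIl _ _) (subset_trans sW sJ) _ oX oW).
    by move=> x y; rewrite in_setI => /andP[_ /common_innP yW] Wx; apply: yW.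
apply/subsetP => v Xv; rewrite !in_setU.
have [//|vJ] := boolP (v \in J); rewrite /=; apply/orP.
have [oq|noq] := pselect (occ e q (outn e v :&: J)).
  right; apply/bigcupP; exists (outn e v :&: J).
    by rewrite inE powersetE subsetIr; apply/asboolP.
  by rewrite in_setI Xv; apply/common_innP => w; rewrite !inE => /andP[].
have [op|nop] := pselect (occ e p (inn e v :&: J)).
  left; apply/bigcupP; exists (inn e v :&: J).
    by rewrite inE powersetE subsetIr; apply/asboolP.
  by rewrite in_setI Xv; apply/common_innP => w; rewrite !inE => /andP[].
case: nJ; apply: (nbhd_colN vJ).
- by apply: Hcq => //; apply: alpha_lt_sub sX; apply: subset_trans sJ; apply: subsetIr.
- by apply: Hcp => //; apply: alpha_lt_sub sX; apply: subset_trans sJ; apply: subsetIr.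
- apply: H0 => //.
    by apply: alpha_lt_sub (alpha_lt_nonn oe Xv sX); apply: setIS.
  move=> oN; apply: nX; apply: occ_sub oN; apply: subset_trans sJ; exact: subsetIr.
Qed.

(** * Chains of bags *)

(** Vertices are coloured in increasing [idx]: the fewer than [m] out-neighbours of [v] under [r]
    have their colours before [v] does. *)
Lemma greedy_coloring (T : finType) (r : rel T) (idx : T -> nat) m :
  (forall v y, r v y -> idx y < idx v) -> (forall v, #|[set y | r v y]| < m) ->
  exists2 c : T -> nat, forall v, c v < m & forall v y, r v y -> c v != c y.
Proof.
move=> ri rm.
suff /(_ (\max_v idx v).+1)[c cm cP] : forall n, exists2 c : T -> nat,
    forall v, c v < m & forall v y, idx v < n -> r v y -> c v != c y.
  by exists c => // v y; apply: cP; rewrite ltnS leq_bigmax.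
elim=> [|n [c cm cP]].
  exists (fun=> 0) => // v; exact: leq_ltn_trans (rm v).
have /choice[u uP] : forall v, exists j, j < m /\ forall y, r v y -> j != c y.
  move=> v; apply: contrapT => nj.
  suff : m <= #|[set y | r v y]| by rewrite leqNgt rm.
  have sub : [set: 'I_m] \subset [set Ordinal (cm y) | y in [set y | r v y]].
    apply/subsetP => j _; apply: contrapT => /negP jc; apply: nj; exists j; split=> // y vy.
    apply: contraNneq jc => jy; apply/imsetP; exists y; rewrite ?inE //.
    exact: val_inj.
  rewrite -[m in m <= _]card_ord -cardsT.
  exact: leq_trans (subset_leq_card sub) (leq_imset_card _ _).
exists (fun v => if idx v == n then u v else c v) => [v|v y].
  by case: ifP => // _; have [] := uP v.
rewrite ltnS leq_eqVlt; case: ifP => /= [/eqP vn _ vy|_ vn vy].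
  have := ri _ _ vy; rewrite vn => yn; rewrite (ltn_eqF yn).
  by have [_] := uP v; apply.
have := ri _ _ vy => yv; rewrite (ltn_eqF (ltn_trans yv vn)).
exact: cP.
Qed.

(* Bags are ordered from left to right; [linked B B'] says that few arcs go back from
   [B'] to [B]. *)
Definition linked (T : finType) (e : rel T) e1 e2 (B B' : {set T}) :=
  [/\ B != B', {in B', forall v, col e e1 (outn e v :&: B)} &
      {in B, forall u, col e e2 (inn e u :&: B')}].

Definition bag_chain (T : finType) (e : rel T) C e1 e2 (X : {set T}) Bs :=
  {in Bs, forall B : {set T}, B \subset X /\ ~ col e C B} /\
  pairwise (fun B B' => `[< linked e e1 e2 B B' >]) Bs.

Section Chain.
Variables (T : finType) (e : rel T) (X : {set T}) (k : nat) (q : pat).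
Variables (m c c0 e1 e2 b C g : nat).
Hypotheses (oe : oriented e) (nX : ~ occ e (Tri (TT k) q) X).
Hypothesis TTm : forall Y : {set T}, Y \subset X -> m <= #|Y| -> occ e (TT k) Y.
Hypothesis colq : forall Y : {set T}, Y \subset X -> ~ occ e q Y -> col e c Y.
Hypothesis coln : {in X, forall v, col e c0 (nonn e v :&: X)}.

Lemma m_gt0 : 0 < m.
Proof.
rewrite lt0n; apply/negP => /eqP m0.
have [|y] := @occ_nonempty _ e (TT k) set0; last by rewrite inE.
by apply: TTm; rewrite ?sub0set ?m0.
Qed.

(** If [Z] had [m] vertices it would contain a small copy [K] of [TT k]. Removing from [S] the
    in-neighbours and non-neighbours of [K] leaves a set containing [q], and [x => K => q => x]. *)
Lemma tri_sparse n x (S Z : {set T}) : x \in X -> S \subset X -> Z \subset X ->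
  S \subset inn e x -> Z \subset outn e x ->
  {in Z, forall y, col e n (inn e y :&: S)} ->
  ~ col e (psize (TT k) * (n + c0) + c) S -> #|Z| < m.
Proof.
move=> Xx sS sZ Sx Zx cZ nS; rewrite ltnNge; apply/negP => mZ.
have /occ_small[K [sK cK oK]] := TTm sZ mZ.
pose F y := inn e y :&: S :|: nonn e y :&: X.
have cF : {in K, forall y, col e (n + c0) (F y)}.
  move=> y /(subsetP sK) Zy; apply: colU; first exact: cZ.
  by apply: coln; apply: (subsetP sZ).
have := col_rem cK cF nS; set S' := _ :\: _ => nS'.
have sS'S : S' \subset S by apply: subsetDl.
have sS' := subset_trans sS'S sS.
have oS' : occ e q S' by apply: contrapT => /(colq sS').
apply: nX; exists x, K, S'; split=> //; first exact: subset_trans sZ.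
split=> //.
- move=> _ y /set1P-> /(subsetP sK)/(subsetP Zx); by rewrite inE.
- move=> y w Ky S'w; have Sw := subsetP sS'S _ S'w.
  have nF : w \notin F y.
    by move: S'w; rewrite inE => /andP[+ _]; apply: contraNN => wF; apply/bigcupP; exists y.
  have := nbhd_cases e y w => /or4P[/eqP wy|yw|wy|yw].
  + have := subsetP Sx _ Sw; have := subsetP Zx _ (subsetP sK _ Ky).
    by rewrite !inE wy => /oe/negPf->.
  + by move: yw; rewrite inE.
  + by move: nF; rewrite in_setU !in_setI wy Sw.
  + by move: nF; rewrite in_setU !in_setI yw (subsetP sS') // orbT.
- move=> w _ /(subsetP sS'S)/(subsetP Sx) + /set1P->; by rewrite inE.
Qed.

(** The threshold of [tri_sparse] for [n := e2]. *)
Let D0 := psize (TT k) * (e2 + c0) + c.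

Hypotheses (me1 : m <= e1) (e1b : e1 <= b).
Hypothesis HC : (b + e1 + e2 + c0 + D0).+1 <= C.
(* If [x] has a large out-neighbourhood [A] and few arcs go back from [S] to [A], then [S]
   can be an in-neighbourhood of [x] only if it is small. *)
Hypothesis small_in : forall x (A S : {set T}), x \in X -> A \subset X -> S \subset X ->
  A \subset outn e x -> S \subset inn e x -> ~ col e b A ->
  {in S, forall v, col e e1 (outn e v :&: A)} -> col e e2 S.
(** Five bags are one more than the at most four that an extension of a chain discards. *)
Hypothesis LC : forall Y : {set T}, Y \subset X -> ~ col e g Y ->
  exists2 Bs, size Bs = 5 & bag_chain e C e1 e2 Y Bs.

Lemma bag_third v n1 n2 (B : {set T}) : v \in X -> B \subset X -> ~ col e C B ->
  col e n1 (outn e v :&: B) -> col e n2 (inn e v :&: B) -> n1 + n2 + c0 < C -> False.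
Proof.
move=> Xv sB nB c1 c2 nC; apply: nB; apply: col_leq nC _.
apply: nbhd_col c1 c2 _ => //; apply: col_sub (coln Xv); exact: setIS.
Qed.

Section Zones.
Variable Bs : seq {set T}.
Hypothesis chBs : bag_chain e C e1 e2 X Bs.

Let B j := nth set0 Bs j.
Let t := size Bs.
Let far v (A : {set T}) := `[< ~ col e b (outn e v :&: A) >].
(** The first bag in which [v] has a large out-neighbourhood, or [t] if there is none. In earlier
    bags the in-neighbourhood of [v] is large, in later ones it is small. *)
Let idx v := find (far v) Bs.

Lemma bagX j : j < t -> B j \subset X.
Proof. by move=> jt; have [] := chBs.1 (B j) (mem_nth _ jt). Qed.

Lemma bagC j : j < t -> ~ col e C (B j).
Proof. by move=> jt; have [] := chBs.1 (B j) (mem_nth _ jt). Qed.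

Lemma bag_linked i j : i < j -> j < t -> linked e e1 e2 (B i) (B j).
Proof.
move=> ij jt; have /(pairwiseP set0)/(_ i j) := chBs.2.
by rewrite !inE (ltn_trans ij jt) => /(_ isT jt ij)/asboolP.
Qed.

Lemma idx_find v : idx v < t -> ~ col e b (outn e v :&: B (idx v)).
Proof.
move=> vt; have : has (far v) Bs by rewrite has_find.
by move/(nth_find set0)/asboolP.
Qed.

Lemma idx_before v j : j < idx v -> col e b (outn e v :&: B j).
Proof.
by move=> /(before_find set0) far_false; apply: contrapT => /asboolP; rewrite -/(far v _) far_false.
Qed.

Lemma idx_le v : idx v <= t. Proof. exact: find_size. Qed.

Lemma idx_after v j : v \in X -> idx v < j -> j < t -> col e e2 (inn e v :&: B j).
Proof.
move=> Xv vj jt; have vt := ltn_trans vj jt.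
apply: (@small_in v (outn e v :&: B (idx v))) => //.
- by apply: subset_trans (bagX vt); apply: subsetIr.
- by apply: subset_trans (bagX jt); apply: subsetIr.
- exact: subsetIl.
- exact: subsetIl.
- exact: idx_find.
- move=> u; rewrite in_setI => /andP[_ Bu]; have [_ /(_ u Bu) cu _] := bag_linked vj jt.
  by apply: col_sub cu; apply: setIS; apply: subsetIr.
Qed.

Lemma idx_before_in v j : v \in X -> j < idx v -> ~ col e D0 (inn e v :&: B j).
Proof.
move=> Xv jv cD; have jt := leq_trans jv (idx_le v).
by apply: (bag_third Xv (bagX jt) (bagC jt) (idx_before jv) cD); lia.
Qed.

(** [tri_sparse] applies with [S] the in-neighbours of [v] in bag [j.+1], a large set because that
    bag also precedes [idx v]. *)
Lemma idx_before2 v j : v \in X -> j.+1 < idx v -> #|outn e v :&: B j| < m.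
Proof.
move=> Xv jv; have jt := leq_trans jv (idx_le v).
apply: (@tri_sparse e2 v (inn e v :&: B j.+1)) => //.
- by apply: subset_trans (bagX jt); apply: subsetIr.
- by apply: subset_trans (bagX (ltnW jt)); apply: subsetIr.
- exact: subsetIl.
- exact: subsetIl.
- move=> y; rewrite in_setI => /andP[_ By].
  have [_ _ /(_ y By) cy] := bag_linked (ltnSn j) jt.
  by apply: col_sub cy; apply: setIS; apply: subsetIr.
- exact: idx_before_in.
Qed.

(** [tri_sparse] applies with [S] the in-neighbours of [v] in the last bag before [idx v]: a vertex
    [y] at least two zones further left has [idx y] before that bag, hence few in-neighbours in
    it. *)
Lemma back_degree v : v \in X -> #|[set y in X | e v y & (idx y).+1 < idx v]| < m.
Proof.
move=> Xv; have [v0|v0] := posnP (idx v).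
  apply: leq_ltn_trans m_gt0; rewrite leqn0 cards_eq0; apply/eqP/setP => y.
  by rewrite !inE v0 !andbF.
have vt : (idx v).-1 < t by have := idx_le v; lia.
apply: (@tri_sparse e2 v (inn e v :&: B (idx v).-1)) => //.
- by apply: subset_trans (bagX vt); apply: subsetIr.
- by apply/subsetP => y; rewrite inE => /andP[].
- exact: subsetIl.
- by apply/subsetP => y; rewrite !inE => /and3P[].
- move=> y; rewrite inE => /and3P[Xy _ yv].
  have yv' : idx y < (idx v).-1 by lia.
  by apply: col_sub (idx_after Xy yv' vt); apply: setIS; apply: subsetIr.
- by apply: idx_before_in => //; lia.
Qed.

(** A smaller index would give [v] many arcs back to an earlier bag. A larger one would make both
    the out- and the in-neighbourhood of [v] in bag [j.+1] small. *)
Lemma bag_idx v j : j < t -> v \in B j -> j <= idx v <= j.+1.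
Proof.
move=> jt Bv; have Xv := subsetP (bagX jt) _ Bv; rewrite leqNgt; apply/andP; split.
  apply/negP => vj; have vt := ltn_trans vj jt.
  apply: (idx_find vt); have [_ /(_ v Bv) cv _] := bag_linked vj jt.
  exact: col_leq e1b cv.
rewrite leqNgt; apply/negP => vj; have jt' := leq_trans vj (idx_le v).
have [_ _ /(_ v Bv) cv] := bag_linked (ltnSn j) jt'.
by apply: (bag_third Xv (bagX jt') (bagC jt') (idx_before vj) cv); lia.
Qed.

Definition zone i := [set v in X | idx v == i].

Lemma zoneP i v : v \in zone i -> v \in X /\ idx v = i.
Proof. by rewrite inE => /andP[-> /eqP]. Qed.

(** Bag [i - 2] is the bridge: a vertex [u] of [B j] has a large out-neighbourhood there, and
    vertices of zone [i] send few arcs back to it, so [small_in] bounds the in-neighbours of [u] in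
    [B']. *)
Lemma left_linked i j (B' : {set T}) : j.+2 < i -> i <= t -> B' \subset zone i ->
  ~ col e C B' -> linked e e1 e2 (B j) B'.
Proof.
move=> ji it sB' nB'; have jt : j < t by lia.
have i2t : i - 2 < t by lia.
have zB' v : v \in B' -> v \in X /\ idx v = i by move/(subsetP sB')/zoneP.
have few v j' : v \in B' -> j' < i.-1 -> col e e1 (outn e v :&: B j').
  move=> /zB'[Xv vi] j'i; apply: col_card oe _; apply: leq_trans me1.
  by apply: ltnW; apply: idx_before2 => //; lia.
split.
- have [v B'v] := not_col_nonempty nB'; have [Xv vi] := zB' _ B'v.
  apply: contraTneq B'v => <-; apply/negP => /(bag_idx jt); lia.
- by move=> v B'v; apply: few => //; lia.
- move=> u Bu; have Xu := subsetP (bagX jt) _ Bu.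
  apply: (@small_in u (outn e u :&: B (i - 2))) => //.
  + by apply: subset_trans (bagX i2t); apply: subsetIr.
  + by apply/subsetP => v; rewrite in_setI => /andP[_ /zB'[]].
  + exact: subsetIl.
  + exact: subsetIl.
  + move=> cu; have [|_ _ /(_ u Bu) cu'] := @bag_linked j (i - 2) _ i2t; first by lia.
    by apply: (bag_third Xu (bagX i2t) (bagC i2t) cu cu'); lia.
  + move=> v; rewrite in_setI => /andP[_ B'v].
    have /col_sub: col e e1 (outn e v :&: B (i - 2)) by apply: few => //; lia.
    by apply; apply: setIS; apply: subsetIr.
Qed.

(** Here bag [i.+1] is the bridge: a vertex of [B j] has a large in-neighbourhood there, while
    vertices of zone [i] have a small one, so [tri_sparse] applies. *)
Lemma right_linked i j (B' : {set T}) : i.+1 < j -> j < t -> B' \subset zone i ->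
  ~ col e C B' -> linked e e1 e2 B' (B j).
Proof.
move=> ij jt sB' nB'; have i1t : i.+1 < t by lia.
have zB' v : v \in B' -> v \in X /\ idx v = i by move/(subsetP sB')/zoneP.
split.
- have [v B'v] := not_col_nonempty nB'; have [Xv vi] := zB' _ B'v.
  apply: contraTneq B'v => ->; apply/negP => /(bag_idx jt); lia.
- move=> v Bv; have Xv := subsetP (bagX jt) _ Bv.
  apply: col_card oe _; apply: leq_trans me1; apply: ltnW.
  apply: (@tri_sparse e2 v (inn e v :&: B i.+1)) => //.
  + by apply: subset_trans (bagX i1t); apply: subsetIr.
  + by apply/subsetP => y; rewrite in_setI => /andP[_ /zB'[]].
  + exact: subsetIl.
  + exact: subsetIl.
  + move=> y; rewrite in_setI => /andP[_ /zB'[Xy yi]].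
    have /col_sub: col e e2 (inn e y :&: B i.+1) by apply: idx_after => //; rewrite yi.
    by apply; apply: setIS; apply: subsetIr.
  + move=> cD; have [_ /(_ v Bv) cv _] := bag_linked ij jt.
    by apply: (bag_third Xv (bagX i1t) (bagC i1t) cv cD); lia.
- by move=> u /zB'[Xu ui]; apply: idx_after => //; lia.
Qed.

(* A large zone [i] contains five linked bags, which replace [B (i - 2)], ..., [B (i + 1)]. *)
Lemma extend_chain i : ~ col e g (zone i) ->
  exists2 Bs', size Bs < size Bs' & bag_chain e C e1 e2 X Bs'.
Proof.
move=> nz; have [v /zoneP[Xv vi]] := not_col_nonempty nz.
have it : i <= t by rewrite -vi; apply: idx_le.
have sz : zone i \subset X by apply/subsetP => w /zoneP[].
have [N sN [bN pN]] := LC sz nz.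
exists (take (i - 2) Bs ++ N ++ drop (i + 2) Bs).
  by rewrite !size_cat sN size_take size_drop -/t; case: ifP; lia.
have inL A : A \in take (i - 2) Bs -> exists2 j, (j < i - 2) && (j < t) & A = B j.
  move=> /(nthP set0)[j]; rewrite size_take -/t => ji <-.
  by exists j; [move: ji; case: ifP; lia|rewrite nth_take //; move: ji; case: ifP; lia].
have inR A : A \in drop (i + 2) Bs -> exists2 j, (i.+1 < j) && (j < t) & A = B j.
  move=> /(nthP set0)[j]; rewrite size_drop -/t => ji <-.
  by exists (i + 2 + j); [lia|rewrite nth_drop].
split.
  move=> A; rewrite !mem_cat => /or3P[/mem_take/(chBs.1)//|/bN[sA nA]|/mem_drop/(chBs.1)//].
  by split=> //; apply: subset_trans sz.
rewrite !pairwise_cat pN (subseq_pairwise (take_subseq _ _) chBs.2).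
rewrite (subseq_pairwise (drop_subseq _ _) chBs.2) !andbT allrel_catr.
apply/andP; split; last first.
  apply/allrelP => A A' /bN[sA nA] /inR[j /andP[ij jt] ->]; apply/asboolP.
  exact: (right_linked ij jt sA nA).
apply/andP; split; apply/allrelP => A A' /inL[j /andP[ji jt] ->].
  move=> /bN[sA nA]; apply/asboolP; apply: (left_linked _ it sA nA); lia.
move=> /inR[j' /andP[ij' jt'] ->]; apply/asboolP; apply: (bag_linked _ jt'); lia.
Qed.

(* Arcs going back by at least two zones have small out-degree, so colouring
   them properly, together with the parity of the zone, leaves only cycles inside a zone. *)
Lemma zones_col : (forall i, col e g (zone i)) -> col e (m * 2 * g) X.
Proof.
move=> cz.
pose r : rel T := fun v y => [&& v \in X, y \in X, e v y & (idx y).+1 < idx v].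
have [||ga gam gaP] := @greedy_coloring T r idx m.
- by move=> v y /and4P[_ _ _]; lia.
- move=> v; have [Xv|Xv] := boolP (v \in X).
    apply: leq_ltn_trans (back_degree Xv); apply: subset_leq_card.
    by apply/subsetP => y; rewrite !inE /r Xv.
  apply: leq_ltn_trans m_gt0; rewrite leqn0 cards_eq0; apply/eqP/setP => y.
  by rewrite !inE /r (negPf Xv).
have /choice[cl clP] : forall i, exists cl : T -> nat,
    {in zone i, forall x, cl x < g} /\ forall j, acy e [set x in zone i | cl x == j].
  by move=> i; have [cl cl1 cl2] := cz i; exists cl.
apply: (@col_fibers _ _ _ _ (fun v => ga v * 2 + odd (idx v))).
  by move=> x _; have := gam x; case: (odd _) => /=; lia.
move=> j _; set W := [set _ in X | _].
have inW v : v \in W -> [/\ v \in X, ga v = j %/ 2 & odd (idx v) = odd j].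
  rewrite inE => /andP[Xv /eqP <-]; split=> //.
    by rewrite divnMDl // divn_small ?addn0 //; case: (odd _).
  by rewrite oddD oddM andbF /= oddb.
exists (fun v => cl (idx v) v) => [v /inW[Xv _ _]|l].
  by apply: (clP (idx v)).1; rewrite inE Xv eqxx.
move=> Y sY Y0.
have YW v : v \in Y -> v \in W /\ cl (idx v) v = l.
  by move=> /(subsetP sY); rewrite inE => /andP[-> /eqP].
have [v0 Yv0] := set0Pn _ Y0.
(* A sink of the part of [Y] in its last zone is a sink of [Y]: parity excludes arcs to the zone
   just before, and [ga] excludes arcs further back. *)
case: (arg_maxnP idx Yv0) => v1 Yv1 maxv.
pose i := idx v1.
have [||y] := (clP i).2 l (Y :&: zone i).
- apply/subsetP => y; rewrite !inE => /andP[Yy /andP[Xy /eqP yi]].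
  by rewrite Xy yi eqxx -yi; have [_ ->] := YW y Yy; rewrite eqxx.
- apply/set0Pn; exists v1; rewrite in_setI; have [/inW[Xv _ _] _] := YW _ Yv1.
  by apply/andP; split=> //; rewrite inE Xv eqxx.
rewrite in_setI => /andP[Yy /zoneP[Xy yi]] ny; exists y => // z Yz.
have [/inW[Xz gz oz] _] := YW _ Yz; have [/inW[_ gy oy] _] := YW _ Yy.
have [zi|zi] := eqVneq (idx z) i.
  by apply: ny; rewrite in_setI Yz inE Xz zi eqxx.
apply/negP => yz; have := gaP y z; rewrite gy gz eqxx /r Xy Xz yz /= => H.
suff : (idx z).+1 < idx y by move/H.
have zi1 : idx z < i by rewrite ltn_neqAle zi; apply: maxv.
rewrite yi ltn_neqAle zi1 andbT; apply/eqP => izi.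
by move: oz; rewrite -oy yi -izi /=; case: (odd _).
Qed.

End Zones.

(** Linked bags are distinct subsets of [T], so a longest chain exists; as it cannot be extended,
    all its zones are [g]-colourable. *)
Theorem chain_col : col e (m * 2 * g) X.
Proof.
pose P n := `[< exists2 Bs, size Bs = n & bag_chain e C e1 e2 X Bs >].
have P0 : exists n, P n.
  by exists 0; apply/asboolP; exists [::]; split.
have Pb n : P n -> n <= #|{set T}|.
  move=> /asboolP[Bs <- [_ pBs]].
  have /card_uniqP <- : uniq Bs.
    rewrite uniq_pairwise; apply: sub_pairwise pBs => A A' /asboolP[]//.
  exact: max_card.
case: (ex_maxnP P0 Pb) => n /asboolP[Bs sBs chBs] maxn.
apply: (zones_col chBs) => i; apply: contrapT => /(extend_chain chBs)[Bs' lt chBs'].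
have : size Bs' <= n by apply: maxn; apply/asboolP; exists Bs'.
by rewrite -sBs leqNgt lt.
Qed.

End Chain.

(** * Triangles with a transitive part *)

Lemma bag_chain_sub (T : finType) (e : rel T) C e1 e2 (X Y : {set T}) Bs :
  X \subset Y -> bag_chain e C e1 e2 X Bs -> bag_chain e C e1 e2 Y Bs.
Proof.
move=> sXY [bBs pBs]; split=> // B /bBs[sB nB]; split=> //.
exact: subset_trans sXY.
Qed.

Lemma bag_chain_cons (T : finType) (e : rel T) C e1 e2 (X A Y : {set T}) Bs :
  A \subset X -> ~ col e C A -> Y \subset X -> bag_chain e C e1 e2 Y Bs ->
  (forall B : {set T}, B \subset Y -> ~ col e C B -> linked e e1 e2 A B) ->
  bag_chain e C e1 e2 X (A :: Bs).
Proof.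
move=> sA nA sY ch lA; have [bBs pBs] := ch; split=> [B|/=].
  by rewrite inE => /predU1P[->//|/(bag_chain_sub sY ch).1].
rewrite pBs andbT; apply/allP => B /bBs[sB nB]; apply/asboolP; exact: lA.
Qed.

Lemma bag_chain_rcons (T : finType) (e : rel T) C e1 e2 (X A Y : {set T}) Bs :
  A \subset X -> ~ col e C A -> Y \subset X -> bag_chain e C e1 e2 Y Bs ->
  (forall B : {set T}, B \subset Y -> ~ col e C B -> linked e e1 e2 B A) ->
  bag_chain e C e1 e2 X (rcons Bs A).
Proof.
move=> sA nA sY ch lA; have [bBs pBs] := ch; split=> [B|/=].
  by rewrite mem_rcons inE => /predU1P[->//|/(bag_chain_sub sY ch).1].
rewrite pairwise_rcons pBs andbT; apply/allP => B /bBs[sB nB]; apply/asboolP; exact: lA.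
Qed.

Lemma linked_full (T : finType) (e : rel T) C e1 e2 (A B : {set T}) : oriented e ->
  ~ col e C A -> full e A B -> linked e e1 e2 A B.
Proof.
move=> oe /not_col_nonempty[x Ax] f; split.
- apply: contraTneq (Ax) => AB; apply/negP => _.
  by have := f x x Ax; rewrite -AB Ax oriented_irr // => /(_ isT).
- move=> v Bv; rewrite (_ : _ :&: _ = set0); first exact: col_set0.
  apply/setP => w; rewrite !inE; apply/negP => /andP[vw Aw].
  by have := oe _ _ vw; rewrite f.
- move=> u Au; rewrite (_ : _ :&: _ = set0); first exact: col_set0.
  apply/setP => w; rewrite !inE; apply/negP => /andP[wu Bw].
  by have := oe _ _ wu; rewrite f.
Qed.

(** If both light neighbourhoods of some [v] are large, the in-neighbours form a bag placed before a
    chain found among the out-neighbours; light arcs at [v] make it linked. Otherwise every vertex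
    has a bounded in- or out-neighbourhood, and [local_to_global] colours each of the two
    classes. *)
Lemma light_chain a b c1 C e1 e2 n : b <= e1 -> b <= e2 -> exists g,
  forall (T : finType) (e h : rel T) Y, oriented e -> alpha_lt e a Y ->
  symmetric h -> light e h b Y -> {in Y, forall v, col e c1 (h_nbhd h v :&: Y)} ->
  ~ col e g Y -> exists2 Bs, size Bs = n & bag_chain e C e1 e2 Y Bs.
Proof.
move=> be1 be2; elim: n => [|n [g IH]].
  by exists 0 => T e h Y _ _ _ _ _ _; exists [::].
pose K := C + g + c1.
have [f Hf] := local_to_global a K c1.
exists (f + f) => T e h Y oe sY sh lh chn nY; have [l1 l2] := lh.
have cnon : {in Y, forall v, col e c1 (nonn e v :&: Y)}.
  by move=> v Yv; apply: col_sub (chn v Yv); apply: nonn_sub_h_nbhd lh.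
pose A v := (outn e v :\: h_nbhd h v) :&: Y.
pose B v := (inn e v :\: h_nbhd h v) :&: Y.
have [[v [Yv nA nB]]|nv] := pselect (exists v,
    [/\ v \in Y, ~ col e g (A v) & ~ col e C (B v)]).
  have sA : A v \subset Y by apply: subsetIr.
  have sB : B v \subset Y by apply: subsetIr.
  have [|Bs sBs chBs] := IH T e h (A v) oe (alpha_lt_sub sA sY) sh (light_sub sA lh) _ nA.
    by move=> w /(subsetP sA)/chn; apply: col_sub; apply: setIS.
  exists (B v :: Bs); first by rewrite /= sBs.
  apply: (bag_chain_cons sB nB sA chBs) => D sD nD; split.
  - have [w Dw] := not_col_nonempty nD; apply: contraTneq (Dw) => <-; apply/negP.
    have := subsetP sD _ Dw; rewrite !inE => /andP[/andP[_ vw] _] /andP[/andP[_ wv] _].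
    by have := oe _ _ vw; rewrite wv.
  - move=> w /(subsetP sD); rewrite !inE => /andP[/andP[nh vw] Yw].
    have wv : w != v by apply: contraTneq vw => ->; rewrite oriented_irr.
    rewrite wv andbT in nh.
    apply: col_leq be1 _; apply: col_sub (l2 v w Yv Yw vw nh).
    by apply/subsetP => u; rewrite !inE => /andP[-> /andP[/andP[_ ->] ->]].
  - move=> u; rewrite !inE => /andP[/andP[nh uv] Yu].
    have uv' : u != v by apply: contraTneq uv => ->; rewrite oriented_irr.
    rewrite uv' andbT sh in nh.
    apply: col_leq be2 _; apply: col_sub (l2 u v Yu Yv uv nh).
    apply/subsetP => w; rewrite !inE => /andP[-> /(subsetP sD)].
    by rewrite !inE => /andP[/andP[_ ->] ->].
case: nY.
pose R := [set v in Y | `[< col e K (outn e v :&: Y) >]].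
pose L := [set v in Y | `[< col e K (inn e v :&: Y) >]].
have sR : R \subset Y by apply/subsetP => v; rewrite inE => /andP[].
have sL : L \subset Y by apply/subsetP => v; rewrite inE => /andP[].
apply: (@col_cover2 _ _ f f _ R L) => //.
- apply: Hf => //.
  + exact: alpha_lt_sub sY.
  + by move=> v; rewrite inE => /andP[_ /asboolP]; apply: col_sub; apply: setIS.
  + by move=> v /(subsetP sR)/cnon; apply: col_sub; apply: setIS.
- apply/col_converse; apply: Hf.
  + exact: oriented_converse.
  + by apply: alpha_lt_converse; apply: alpha_lt_sub sY.
  + move=> v; rewrite inE => /andP[_ /asboolP cv]; apply/col_converse.
    by apply: col_sub cv; apply: setIS.
  + move=> v /(subsetP sL)/cnon cv; rewrite nonn_converse; apply/col_converse.
    by apply: col_sub cv; apply: setIS.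
- apply/subsetP => v Yv; rewrite in_setU !inE Yv /=.
  have [cA|nA] := pselect (col e g (A v)).
    apply/orP; left; apply/asboolP.
    apply: col_cover2 cA (chn v Yv) _ _; last by rewrite /K; lia.
    by apply/subsetP => w; rewrite !inE; case: (h v w && _) => /=; case: (e v w) => //= ->.
  have [cB|nB] := pselect (col e C (B v)).
    apply/orP; right; apply/asboolP.
    apply: col_cover2 cB (chn v Yv) _ _; last by rewrite /K; lia.
    by apply/subsetP => w; rewrite !inE; case: (h v w && _) => /=; case: (e w v) => //= ->.
  by case: nv; exists v.
Qed.

Lemma tri_light_bounded k q a : superhero q a -> light_bounded (Tri (TT k) q) a.
Proof.
move=> [c Hc] b; elim=> [|s [c1 IH]].
  exists 0 => T e h X _ _ _ _ /(_ set0); rewrite sub0set cards0 => H.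
  by have : 0 < 0 by apply: H => // x; rewrite inE.
have [m Hm] := oriented_TT a k.
pose e1 := m + b; pose e2 := c1 + b; pose bP := b + e1 + c1.
pose C := (bP + e1 + e2 + c1 + (psize (TT k) * (e2 + c1) + c)).+1.
have [g Hg] := @light_chain a b c1 C e1 e2 5 (leq_addl _ _) (leq_addl _ _).
exists (m * 2 * g) => T e h X oe sX nX sh cl lh; have [l1 l2] := lh.
have nY (Y : {set T}) : Y \subset X -> ~ occ e (Tri (TT k) q) Y.
  by move=> sY oY; apply: nX; apply: occ_sub oY.
have chn : {in X, forall v, col e c1 (h_nbhd h v :&: X)}.
  move=> v Xv; have sV : h_nbhd h v :&: X \subset X by apply: subsetIr.
  apply: (IH T e h _ oe (alpha_lt_sub sV sX) (nY _ sV) sh).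
    exact: clique_lt_nbhd.
  exact: light_sub sV _.
apply: (@chain_col T e X k q m c c1 e1 e2 bP C g) => //.
- by move=> Y sY; apply: Hm => //; apply: alpha_lt_sub sX.
- by move=> Y sY; apply: Hc => //; apply: alpha_lt_sub sX.
- by move=> v Xv; apply: col_sub (chn v Xv); apply: nonn_sub_h_nbhd lh.
- exact: leq_addr.
- by rewrite /bP; lia.
(* [S] lies in the [h]-neighbourhood of [x]. If instead the arc from [w] in [S] to [x] were light,
   [A] would split into at most [e1] colours of out-neighbours of [w], [b] of in-neighbours and [c1]
   of non-neighbours, in total [bP]. *)
- move=> x A S Xx sA sS Ax Sx nA cS.
  apply: (@col_leq _ _ c1); first exact: leq_addr.
  apply: col_sub (chn x Xx); apply/subsetP => w Sw; rewrite in_setI (subsetP sS) // andbT.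
  have := subsetP Sx _ Sw; rewrite !inE => wx.
  have wx' : w != x by apply: contraTneq wx => ->; rewrite oriented_irr.
  rewrite wx' andbT; apply: contraT => nh; case: nA.
  have Xw := subsetP sS _ Sw.
  have wA : w \notin A.
    apply/negP => /(subsetP Ax); rewrite inE => xw; by have := oe _ _ xw; rewrite wx.
  have cw : col e b (outn e x :&: inn e w :&: X) by apply: l2 => //; rewrite sh.
  rewrite /bP [b + e1]addnC; apply: (nbhd_colN wA (cS w Sw)).
    apply: col_sub cw; apply/subsetP => z; rewrite in_setI => /andP[zw Az].
    by rewrite !in_setI zw (subsetP Ax) // (subsetP sA).
  apply: col_sub (chn w Xw); apply: subset_trans (nonn_sub_h_nbhd Xw lh).
  exact: setIS.
- move=> Y sY nYc; apply: (Hg T e h Y) => //.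
  + exact: alpha_lt_sub sX.
  + exact: light_sub lh.
  + by move=> v /(subsetP sY)/chn; apply: col_sub; apply: setIS.
Qed.

(** Sort the vertices outside a jewel [J] by their out- and in-neighbourhoods [W.1] and [W.2] in
    [J]. Some class is large and contains a shorter chain. Since [J] is not [C + C + c0]-colourable,
    [W.1] or [W.2] is not [C]-colourable; it becomes a last or a first bag, completely joined to the
    class. *)
Lemma jewel_chain p a c0 C e1 e2 n : has_jewels p a -> exists g,
  forall (T : finType) (e : rel T) Y, oriented e -> alpha_lt e a Y -> ~ occ e p Y ->
  {in Y, forall v, col e c0 (nonn e v :&: Y)} ->
  ~ col e g Y -> exists2 Bs, size Bs = n & bag_chain e C e1 e2 Y Bs.
Proof.
move=> Hj; have [b [N HJ]] := Hj (C + C + c0); elim: n => [|n [g IH]].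
  by exists 0 => T e Y _ _ _ _ _; exists [::].
exists (b + (N + 2 ^ N * 2 ^ N * g)) => T e Y oe sY nY cnon nc.
have [cY|[J [sJ cJ nJ]]] := HJ T e Y oe sY nY.
  by case: nc; apply: col_leq cY; apply: leq_addr.
pose S (W : {set T} * {set T}) :=
  [set v in Y :\: J | (outn e v :&: J == W.1) && (inn e v :&: J == W.2)].
have [W nW] : exists W, ~ col e g (S W).
  apply: contrapT => nW; apply: nc.
  apply: (@col_leq _ _ (N + 2 ^ N * 2 ^ N * g)); first exact: leq_addl.
  pose Ws := setX (powerset J) (powerset J).
  have cWs : #|Ws| <= 2 ^ N * 2 ^ N.
    by rewrite cardsX card_powerset leq_mul // leq_exp2l.
  apply: (@col_cover2 _ _ N (2 ^ N * 2 ^ N * g) _ J (\bigcup_(W in Ws) S W)) => //.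
  - exact: col_card.
  - apply: (col_bigcup (subxx _) cWs) => W _; apply: contrapT => nS.
    by apply: nW; exists W.
  - apply/subsetP => v Yv; rewrite in_setU; have [//|vJ] := boolP (v \in J).
    rewrite /=; apply/bigcupP; exists (outn e v :&: J, inn e v :&: J).
      by rewrite in_setX !powersetE !subsetIr.
    by rewrite !inE vJ Yv !eqxx.
have sS : S W \subset Y by apply/subsetP => v; rewrite !inE => /andP[/andP[]].
have [Bs sBs chBs] : exists2 Bs, size Bs = n & bag_chain e C e1 e2 (S W) Bs.
  apply: IH => //; first exact: alpha_lt_sub sY.
    by move=> oS; apply: nY; apply: occ_sub oS.
  by move=> v /(subsetP sS)/cnon; apply: col_sub; apply: setIS.
have SP v : v \in S W -> [/\ v \in Y, v \notin J, outn e v :&: J = W.1 & inn e v :&: J = W.2].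
  by rewrite inE in_setD => /andP[/andP[vJ Yv] /andP[/eqP <- /eqP <-]].
have [v Sv] := not_col_nonempty nW; have [Yv vJ vo vi] := SP _ Sv.
have sW1 : W.1 \subset Y by rewrite -vo; apply: subset_trans sJ; apply: subsetIr.
have sW2 : W.2 \subset Y by rewrite -vi; apply: subset_trans sJ; apply: subsetIr.
have [c1|n1] := pselect (col e C W.1); last first.
  exists (rcons Bs W.1); first by rewrite size_rcons sBs.
  apply: (bag_chain_rcons sW1 n1 sS chBs) => B sB nB.
  apply: (linked_full _ _ oe nB) => x w /(subsetP sB)/SP[_ _ <- _].
  by rewrite !inE => /andP[].
have [c2|n2] := pselect (col e C W.2); last first.
  exists (W.2 :: Bs); first by rewrite /= sBs.
  apply: (bag_chain_cons sW2 n2 sS chBs) => B sB nB.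
  apply: (linked_full _ _ oe n2) => w x Ww /(subsetP sB)/SP[_ _ _ Wx].
  by move: Ww; rewrite -Wx !inE => /andP[].
case: nJ; apply: (nbhd_colN vJ); rewrite ?vo ?vi //.
by apply: col_sub (cnon v Yv); apply: setIS.
Qed.

Theorem tri_superhero k q : (forall a, superhero q a) ->
  forall a, superhero (Tri (TT k) q) a.
Proof.
move=> Hq; elim=> [|a [c0 H0]]; first by exists 0 => T e X _ /not_alpha_lt0.
have [c Hc] := Hq a.+1; have [m Hm] := oriented_TT a.+1 k.
have HJ := light_bounded_jewels (@tri_light_bounded k q a.+1 (Hq a.+1)).
have [bJ [N HJm]] := HJ (m + m + c0).
pose e2 := 2 ^ N * c; pose bP := bJ + m.
pose C := (bP + m + e2 + c0 + (psize (TT k) * (e2 + c0) + c)).+1.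
have [g Hg] := @jewel_chain _ _ c0 C m e2 5 HJ.
exists (m * 2 * g) => T e X oe sX nX.
have nY (Y : {set T}) : Y \subset X -> ~ occ e (Tri (TT k) q) Y.
  by move=> sY oY; apply: nX; apply: occ_sub oY.
have cnon : {in X, forall v, col e c0 (nonn e v :&: X)}.
  move=> v Xv; apply: H0 => //; first exact: alpha_lt_nonn.
  by apply: nY; apply: subsetIr.
have Hm' (Y : {set T}) : Y \subset X -> m <= #|Y| -> occ e (TT k) Y.
  by move=> sY; apply: Hm => //; apply: alpha_lt_sub sX.
have Hc' (Y : {set T}) : Y \subset X -> ~ occ e q Y -> col e c Y.
  by move=> sY; apply: Hc => //; apply: alpha_lt_sub sX.
apply: (@chain_col T e X k q m c c0 m e2 bP C g) => //.
- exact: leq_addl.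
(* [A] contains a jewel [J]. A vertex of [S] has few out- and non-neighbours in [J], hence a copy of
   [TT k] among its in-neighbours there. The vertices of [S] dominated by one such copy [W] contain
   no [q], since [x => W => q => x] would be forbidden, and there are at most [2 ^ N] choices of
   [W]. *)
- move=> x A S Xx sA sS Ax Sx nA cS.
  have [cA|[J [sJ cJ nJ]]] := HJm T e A oe (alpha_lt_sub sA sX) (nY _ sA).
    by case: nA; apply: col_leq cA; apply: leq_addr.
  have sJX := subset_trans sJ sA.
  pose Ws := [set W in powerset J | `[< occ e (TT k) W >]].
  have cWs : #|Ws| <= 2 ^ N.
    apply: (@leq_trans #|powerset J|); last by rewrite card_powerset leq_exp2l.
    by apply: subset_leq_card; apply/subsetP => W; rewrite inE => /andP[].
  apply: (@col_bigcup _ _ _ _ _ Ws (fun W => S :&: common_inn (converse e) W)) => //.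
    apply/subsetP => v Sv; have vJ : v \notin J.
      apply/negP => /(subsetP sJ)/(subsetP Ax); have := subsetP Sx _ Sv.
      by rewrite !inE => /oe/negPf->.
    have oJ : occ e (TT k) (inn e v :&: J).
      have sI : inn e v :&: J \subset X by apply: subset_trans sJX; apply: subsetIr.
      apply: Hm' => //; rewrite leqNgt; apply/negP => lt; apply: nJ.
      apply: (nbhd_colN vJ).
      + by apply: col_sub (cS v Sv); apply: setIS.
      + by apply: col_card => //; apply: ltnW.
      + by apply: col_sub (cnon v (subsetP sS _ Sv)); apply: setIS.
    apply/bigcupP; exists (inn e v :&: J).
      by rewrite inE powersetE subsetIr; apply/asboolP.
    by rewrite in_setI Sv; apply/common_innP => w; rewrite !inE => /andP[].
  move=> W; rewrite inE powersetE => /andP[sW /asboolP oW].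
  have sI : S :&: common_inn (converse e) W \subset X.
    by apply: subset_trans sS; apply: subsetIl.
  apply: Hc' => // oI; apply: nX; exists x, W, (S :&: common_inn (converse e) W).
  split=> //; first exact: subset_trans sJX.
  split=> //.
  + by move=> y w /set1P-> /(subsetP sW)/(subsetP sJ)/(subsetP Ax); rewrite inE.
  + by move=> w v Ww; rewrite in_setI => /andP[_ /common_innP]; apply.
  + by move=> v y; rewrite in_setI => /andP[/(subsetP Sx) vx _] /set1P->; move: vx; rewrite inE.
- move=> Y sY; apply: Hg => //.
  + exact: alpha_lt_sub sX.
  + exact: nY.
  + by move=> v /(subsetP sY)/cnon; apply: col_sub; apply: setIS.
Qed.

Lemma superhero_converse p : (forall a, superhero p a) ->
  forall a, superhero (pconv p) a.
Proof.
move=> Hp a; have [m Hm] := Hp a; exists m => T e X oe sX nX.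
apply/col_converse; apply: Hm.
- exact: oriented_converse.
- exact: alpha_lt_converse.
- by move=> /occ_converse.
Qed.

Lemma superhero_weaken p p' : (forall (T : finType) (e : rel T) X, oriented e ->
    occ e p' X -> occ e p X) ->
  (forall a, superhero p' a) -> forall a, superhero p a.
Proof.
move=> pp' Hp a; have [m Hm] := Hp a; exists m => T e X oe sX nX.
by apply: Hm => // oX; apply: nX; apply: pp'.
Qed.

Theorem tri_superhero' k q : (forall a, superhero q a) ->
  forall a, superhero (Tri q (TT k)) a.
Proof.
move=> Hq; apply: (@superhero_weaken _ (pconv (Tri (TT k) (pconv q)))).
  move=> T e X oe /= [x [A [B [Xx sA sB [f1 f2 f3]]]]]; rewrite pconvK => oA oB.
  exists x, A, B; split=> //; split=> //; exact: pconv_TT_occ.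
by apply: superhero_converse; apply: tri_superhero; apply: superhero_converse.
Qed.

(** * The patterns to which the preceding theorems apply *)

Inductive constructible : pat -> Prop :=
| constr_one : constructible One
| constr_seq p q : constructible p -> constructible q -> constructible (Seq p q)
| constr_tri k p : constructible p -> constructible (Tri (TT k) p)
| constr_tri' k p : constructible p -> constructible (Tri p (TT k)).

Theorem constructible_superhero p : constructible p -> forall a, superhero p a.
Proof.
elim=> [|p1 q _ IHp _ IHq|k p1 _ IH|k p1 _ IH] => [a|a|a|a].
- exists 0 => T e X _ _ /negP; rewrite negbK => /eqP->; exact: col_set0.
- exact: seq_superhero.
- exact: tri_superhero.
- exact: tri_superhero'.
Qed.

(** * Structure of heroes *)

Section Fits.
Context {T : finType}.
Implicit Types (e : rel T) (A B Y Z : {set T}).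

(** Parts may be empty, so [Y] may realise only a portion of [p]; with [Z] empty, [Tri] degenerates
    to an ordered sum. *)
Fixpoint fits e p Y : Prop := match p with
  | One => #|Y| <= 1
  | Seq p q => exists A B, [/\ Y \subset A :|: B, full e A B, fits e p A & fits e q B]
  | Tri p q => exists Z A B, [/\ Y \subset Z :|: A :|: B, #|Z| <= 1,
      [/\ full e Z A, full e A B & full e B Z], fits e p A & fits e q B]
  end.

Lemma fits_embedding e p Y (T' : finType) (e' : rel T') X : oriented e ->
  fits e p Y -> occ e' p X ->
  exists2 f : T -> T', forall y, f y \in X &
    {in Y &, forall x y, e x y -> e' (f x) (f y)}.
Proof.
move=> oe; elim: p Y X => [|p IHp q IHq|p IHp q IHq] Y X /=.
- move=> Y1 /set0Pn[x Xx]; exists (fun=> x) => // y z Yy Yz.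
  by rewrite (card_le1_eqP Y1 _ _ Yy Yz) oriented_irr.
- move=> [A [B [sY fAB /IHp HA /IHq HB]]] [A' [B' [sA' sB' f' /HA[f fX fe] /HB[g gX ge]]]].
  exists (fun y => if y \in A then f y else g y) => [y|y z Yy Yz yz].
    by case: ifP => _; [apply: (subsetP sA')|apply: (subsetP sB')].
  have := subsetP sY _ Yy; have := subsetP sY _ Yz; rewrite !in_setU.
  have [Ay|Ay] := boolP (y \in A); have [Az|Az] := boolP (z \in A) => /= Bz By.
  + exact: fe.
  + exact: f'.
  + by have := oe _ _ yz; rewrite fAB.
  + exact: ge.
- move=> [Z [A [B [sY Z1 [fZA fAB fBZ] /IHp HA /IHq HB]]]].
  move=> [x [A' [B' [Xx sA' sB' [f1 f2 f3 /HA[f fX fe] /HB[g gX ge]]]]]].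
  exists (fun y => if y \in Z then x else if y \in A then f y else g y) => [y|y z Yy Yz yz].
    by do 2?case: ifP => _ //; [apply: (subsetP sA')|apply: (subsetP sB')].
  have := subsetP sY _ Yy; have := subsetP sY _ Yz; rewrite !in_setU.
  have [Zy|Zy] := boolP (y \in Z); have [Zz|Zz] := boolP (z \in Z).
  + by move: yz; rewrite (card_le1_eqP Z1 _ _ Zy Zz) oriented_irr.
  + have [Az|Az] := boolP (z \in A) => /= Bz _; first by apply: f1; rewrite ?inE.
    by have := oe _ _ yz; rewrite fBZ.
  + have [Ay|Ay] := boolP (y \in A) => /= _ By; last by apply: f3; rewrite ?inE.
    by have := oe _ _ yz; rewrite fZA.
  + have [Ay|Ay] := boolP (y \in A); have [Az|Az] := boolP (z \in A) => /= Bz By.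
    * exact: fe.
    * exact: f2.
    * by have := oe _ _ yz; rewrite fAB.
    * exact: ge.
Qed.

Definition triangle_in e A := exists x y z,
  [/\ x \in A, y \in A, z \in A & [/\ e x y, e y z & e z x]].

Definition total_on_distinct e := forall x y, x != y -> e x y || e y x.

(* A vertex of minimal out-degree in [Y] is a sink: an out-neighbour [z] of [y] has its
   out-neighbours among those of [y] when there is no directed triangle. *)
Lemma no_triangle_acy e A : oriented e -> total_on_distinct e ->
  ~ triangle_in e A -> acy e A.
Proof.
move=> oe te nt Y sY /set0Pn[y0 Yy0].
case: (arg_minnP (fun y => #|outn e y :&: Y|) Yy0) => y Yy miny.
exists y => // z Yz; apply/negP => yz; have := miny z Yz; rewrite leqNgt => /negP; apply.
apply: proper_card; apply/properP; split; last first.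
  by exists z; rewrite !inE ?yz ?Yz // oriented_irr.
apply/subsetP => w; rewrite !inE => /andP[zw Yw]; rewrite Yw andbT.
have wy : y != w by apply: contraTneq zw => <-; apply: oe.
have /orP[//|wy'] := te _ _ wy.
by case: nt; exists y, z, w; split; rewrite ?(subsetP sY).
Qed.

(** A source, provided by [acy_converse], is split off repeatedly. *)
Lemma acy_fits_TT e A : oriented e -> total_on_distinct e -> acy e A ->
  exists k, fits e (TT k) A.
Proof.
move=> oe te; move: {2}#|A| (leqnn #|A|) => n; elim: n A => [|n IH] A An aA.
  by exists 0; apply: leq_trans An _.
have [A0|A0] := eqVneq A set0; first by exists 0; rewrite A0 /= cards0.
have [v Av vs] := acy_converse aA (subxx A) A0.
have [|k fk] := IH (A :\ v) _ (acy_sub (subsetDl _ _) aA).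
  by move: An; rewrite (cardsD1 v A) Av.
exists k.+1, [set v], (A :\ v); rewrite /= cards1; split=> //.
  by rewrite setD1K.
move=> x y /set1P->; rewrite !inE => /andP[yv Ay].
have := te _ _ yv; rewrite orbC => /orP[//|yv'].
by have := vs y Ay; rewrite /converse yv'.
Qed.

Fixpoint nested_pat n := if n is n'.+1 then Tri (nested_pat n') (nested_pat n') else One.

(** At each level with a nonempty apex [Z], one of [A] and [B] has no directed triangle, hence is
    transitive; with [Z] empty the level is an ordered sum. *)
Lemma fits_nested_pat_constructible e n Y : oriented e -> total_on_distinct e ->
  (forall x A B, full e [set x] A -> full e A B -> full e B [set x] ->
     triangle_in e A -> triangle_in e B -> False) ->
  fits e (nested_pat n) Y -> exists2 p, constructible p & fits e p Y.
Proof.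
move=> oe te nQ; elim: n Y => [|n IH] Y /=.
  by move=> Y1; exists One => //; apply: constr_one.
move=> [Z [A [B [sY Z1 [fZA fAB fBZ] /[dup] fA /IH[p cp pA] /[dup] fB /IH[q cq qB]]]]].
have [Z0|/set0Pn[x Zx]] := eqVneq Z set0.
  exists (Seq p q); first exact: constr_seq.
  by exists A, B; split=> //; apply: subset_trans sY _; rewrite Z0 set0U.
have sx : [set x] \subset Z by rewrite sub1set.
have fxA := full_sub sx (subxx A) fZA; have fBx := full_sub (subxx B) sx fBZ.
have [tA|/(no_triangle_acy oe te)/(acy_fits_TT oe te)[k kA]] := pselect (triangle_in e A).
  have [tB|/(no_triangle_acy oe te)/(acy_fits_TT oe te)[k kB]] := pselect (triangle_in e B).
    by case: (nQ x A B).
  by exists (Tri p (TT k)); [apply: constr_tri'|exists Z, A, B].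
by exists (Tri (TT k) q); [apply: constr_tri|exists Z, A, B].
Qed.

End Fits.

(** * Passage between digraphs and relations on sets *)

Lemma tournament_oriented (D : digraph) : tournament D -> oriented (@arc D).
Proof.
move=> tD x y xy; have [xy'|/tD] := eqVneq x y.
  by move: xy; rewrite xy' arc_irrefl.
by rewrite xy; case: (arc y x).
Qed.

Lemma tournament_total (D : digraph) : tournament D -> total_on_distinct (@arc D).
Proof. by move=> tD x y /tD; case: (arc x y). Qed.

(** The vertices of a directed cycle form a set without sink. *)
Lemma acy_acyclic (D : digraph) (P : pred D) :
  acy (@arc D) [set x | P x] -> acyclic (induced P).
Proof.
move=> aP [s [s0 /andP[cs us]]].
have [||y] := aP [set val x | x in s].
- by apply/subsetP => y /imsetP[x _ ->]; rewrite inE; apply: valP.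
- case: s s0 {cs us} => // x s _; apply/set0Pn; exists (val x).
  by apply: imset_f; rewrite inE eqxx.
move=> /imsetP[x xs ->] /(_ (val (next s x))).
rewrite imset_f ?mem_next // => /(_ isT)/negP; apply.
exact: (next_cycle cs xs).
Qed.

Lemma acy_acyclicT (D : digraph) : acy (@arc D) setT -> acyclic D.
Proof.
move=> aD [s [s0 /andP[cs us]]].
have [||y] := aD [set x in s]; first exact: subsetT.
- case: s s0 {cs us} => // x s _; apply/set0Pn; exists x; by rewrite !inE eqxx.
rewrite inE => ys /(_ (next s y)); rewrite inE mem_next => /(_ ys)/negP; apply.
exact: (next_cycle cs ys).
Qed.

Lemma dicolorable_leq (D : digraph) m n : m <= n -> dicolorable D m -> dicolorable D n.
Proof.
move=> mn [c cP]; exists (fun x => widen_ord mn (c x)) => i [s [s0 /andP[cs us]]].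
case: s s0 cs us => // x0 s _ cs us.
have im : i < m by rewrite -(eqP (valP x0)) /=.
apply: (cP (Ordinal im)).
have iP (x : {x | widen_ord mn (c x) == i}) : c (val x) == Ordinal im.
  by apply/eqP/val_inj; have /eqP/(congr1 val) := valP x.
pose f (x : {x | widen_ord mn (c x) == i}) : {x | c x == Ordinal im} := Sub (val x) (iP x).
exists (map f (x0 :: s)); split=> //; apply/andP; split.
  by rewrite cycle_map; apply: sub_cycle cs => x y.
by rewrite map_inj_uniq // => x y /(congr1 val)/= /val_inj.
Qed.

Lemma dichromatic_numberP (D : digraph) m : dichromatic_number D <= m <-> dicolorable D m.
Proof.
rewrite /dichromatic_number; case: ex_minnP => n /asboolP nD minn; split.
  by move=> nm; apply: dicolorable_leq nD.
by move=> mD; apply: minn; apply/asboolP.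
Qed.

Lemma col_dicolorable (D : digraph) m : col (@arc D) m setT -> dicolorable D m.
Proof.
move=> [c cm ac]; exists (fun x => Ordinal (cm x (in_setT x))) => i.
apply: acy_acyclic.
apply: acy_sub (ac i); apply/subsetP => x; rewrite !inE => /eqP <-; exact: eqxx.
Qed.

Lemma dicoloring_triangle (D : digraph) m (c : D -> 'I_m) x y z : dicoloring c ->
  c x = c y -> c y = c z -> arc x y -> arc y z -> arc z x -> False.
Proof.
move=> cP xy yz exy eyz ezx; apply: (cP (c x)).
have px : c x == c x by []. have py : c y == c x by rewrite xy.
have pz : c z == c x by rewrite xy yz.
exists [:: Sub x px; Sub y py; Sub z pz]; split=> //.
apply/andP; split; first by rewrite /= /induced_arc /= exy eyz ezx.
rewrite /= !inE -!val_eqE /= andbT negb_or.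
have ne u v : arc u v -> (u == v :> D) = false.
  by move=> uv; apply/negbTE; apply: contraTneq uv => ->; rewrite arc_irrefl.
by rewrite (ne x y) // (ne y z) // eq_sym (ne z x).
Qed.

Lemma dicoloring_digon (D : digraph) m (c : D -> 'I_m) x y : dicoloring c ->
  c x = c y -> arc x y -> arc y x -> False.
Proof.
move=> cP xy exy eyx; apply: (cP (c x)).
have px : c x == c x by []. have py : c y == c x by rewrite xy.
exists [:: Sub x px; Sub y py]; split=> //.
apply/andP; split; first by rewrite /= /induced_arc /= exy eyx.
rewrite /= !inE -!val_eqE /= andbT.
by apply: contraTneq exy => ->; rewrite arc_irrefl.
Qed.

Lemma contains_induced_embedding (D F : digraph) (f : F -> D) : injective f ->
  (forall x y, arc (f x) (f y) = arc x y) -> contains_induced D F.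
Proof.
move=> fi fe; exists (fun y => y \in codom f).
have fc x : f x \in codom f by apply: codom_f.
exists (fun x => Sub (f x) (fc x)); split=> //.
exists (fun y => iinv (valP y)).
  move=> x; apply: fi; by rewrite f_iinv.
by move=> y; apply: val_inj; rewrite /= f_iinv.
Qed.

Lemma embedding_contains_induced (D F : digraph) : contains_induced D F ->
  exists2 f : F -> D, injective f & forall x y, arc (f x) (f y) = arc x y.
Proof.
move=> [P [f [fb fe]]]; exists (val \o f).
  by apply: inj_comp val_inj (bij_inj fb).
by move=> x y; rewrite -fe.
Qed.

(** An arc-preserving map from a tournament into an oriented relation is injective and reflects
    arcs. *)
Lemma fits_contains_induced (D H : digraph) (e : rel D) p (X : {set D}) : tournament H ->
  oriented e -> {in X &, forall x y, e x y = arc x y} ->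
  fits (@arc H) p setT -> occ e p X -> contains_induced D H.
Proof.
move=> tH oe eX fH oX; have oH := tournament_oriented tH.
have [f fX fe] := fits_embedding oH fH oX.
have fa x y : arc x y -> arc (f x) (f y).
  by move=> xy; rewrite -eX //; apply: fe; rewrite ?inE.
apply: (@contains_induced_embedding _ _ f).
  move=> x y xy; apply/eqP; apply: contraT => /(tournament_total tH) /orP[] /fa;
  by rewrite xy arc_irrefl.
move=> x y; have [xy|nxy] := boolP (arc x y); first exact: fa.
have [->|xy] := eqVneq x y; first exact: arc_irrefl.
have := tournament_total tH xy; rewrite (negPf nxy) /= => yx.
by have := fe y x; rewrite !inE -(eX (f x)) // => /(_ isT isT yx)/oe/negPf.
Qed.

(** * Nested triangles and their dichromatic number *)

Definition tri_arc (A B : digraph) : rel (option (A + B)) := fun u v =>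
  match u, v with
  | None, Some (inl _) | Some (inl _), Some (inr _) | Some (inr _), None => true
  | Some (inl x), Some (inl y) => arc x y
  | Some (inr x), Some (inr y) => arc x y
  | _, _ => false
  end.

Lemma tri_arc_irrefl A B : irreflexive (@tri_arc A B).
Proof. by case=> [[x|x]|] //=; apply: arc_irrefl. Qed.

Definition tri_digraph A B := Digraph (@tri_arc_irrefl A B).

Fixpoint nested_triangle n : digraph :=
  if n is n'.+1 then tri_digraph (nested_triangle n') (nested_triangle n')
  else @Digraph unit (fun _ _ => false) (fun _ => erefl).

Definition nested_triangle_pt n : nested_triangle n := match n with 0 => tt | _.+1 => None end.

Lemma nested_triangle_tournament n : tournament (nested_triangle n).
Proof.
elim: n => [[] []|n IH] //.
by move=> [[x|x]|] [[y|y]|] //= xy; apply: IH; apply: contraNneq xy => ->.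
Qed.

Lemma nested_triangle_fits n (T : finType) (e : rel T) (f : T -> nested_triangle n) (Y : {set T}) :
  {in Y &, injective f} -> {in Y &, forall x y, arc (f x) (f y) = e x y} ->
  fits e (nested_pat n) Y.
Proof.
elim: n f Y => [|n IH] f Y fi fe /=.
  by apply/card_le1_eqP => x y Yx Yy; apply: fi => //; case: (f x); case: (f y).
pose Z := [set y in Y | f y == None].
pose A := [set y in Y | if f y is Some (inl _) then true else false].
pose B := [set y in Y | if f y is Some (inr _) then true else false].
exists Z, A, B; split.
- by apply/subsetP => y Yy; rewrite !inE Yy; case: (f y) => [[]|].
- apply/card_le1_eqP => x y; rewrite !inE => /andP[Yx /eqP fx] /andP[Yy /eqP fy].
  by apply: fi; rewrite ?fx.
- split=> x y; rewrite !inE => /andP[Yx fx] /andP[Yy fy]; rewrite -fe //;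
  by move: fx fy; case: (f x) => [[?|?]|] //=; case: (f y) => [[?|?]|].
- apply: (IH (fun y => if f y is Some (inl a) then a else nested_triangle_pt n)) => x y;
    rewrite !inE => /andP[Yx fx] /andP[Yy fy].
    move: fx fy (fi x y Yx Yy).
    by case: (f x) => [[a|?]|] //=; case: (f y) => [[a'|?]|] // _ _ H aa'; apply: H; rewrite aa'.
  rewrite -fe //; move: fx fy.
  by case: (f x) => [[a|?]|] //=; case: (f y) => [[a'|?]|].
- apply: (IH (fun y => if f y is Some (inr a) then a else nested_triangle_pt n)) => x y;
    rewrite !inE => /andP[Yx fx] /andP[Yy fy].
    move: fx fy (fi x y Yx Yy).
    by case: (f x) => [[?|a]|] //=; case: (f y) => [[?|a']|] // _ _ H aa'; apply: H; rewrite aa'.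
  rewrite -fe //; move: fx fy.
  by case: (f x) => [[?|a]|] //=; case: (f y) => [[?|a']|].
Qed.

(** If the colour of the apex occurs in both copies, it gives a triangle; otherwise one copy avoids
    this colour and the induction has one colour less. *)
Lemma nested_triangle_monochromatic n (P : seq nat) (c : nested_triangle n -> nat) : (forall x, c x \in P) ->
  size P <= n -> exists x y z, [/\ arc x y, arc y z, arc z x & c x = c y /\ c y = c z].
Proof.
elim: n P c => [|n IH] P c cP Pn.
  by move: (cP tt); rewrite leqn0 size_eq0 in Pn; rewrite (eqP Pn).
pose q := c None; pose P' := filter (predC1 q) P.
have P'n : size P' <= n.
  rewrite -ltnS; apply: leq_trans Pn; rewrite size_filter -(count_predC (pred1 q)).
  rewrite -[X in X < _]add0n ltn_add2r -has_count; apply/hasP; exists q => //=; exact: cP.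
have [[x cx]|nx] := pselect (exists x, c (Some (inl x)) = q); last first.
  have [x|x [y [z [xy yz zx [cxy cyz]]]]] := IH P' (fun x => c (Some (inl x))) _ P'n.
    by rewrite mem_filter cP andbT; apply/eqP => xq; apply: nx; exists x.
  by exists (Some (inl x)), (Some (inl y)), (Some (inl z)).
have [[y cy]|ny] := pselect (exists x, c (Some (inr x)) = q); last first.
  have [x'|x' [y [z [xy yz zx [cxy cyz]]]]] := IH P' (fun x => c (Some (inr x))) _ P'n.
    by rewrite mem_filter cP andbT; apply/eqP => xq; apply: ny; exists x'.
  by exists (Some (inr x')), (Some (inr y)), (Some (inr z)).
by exists None, (Some (inl x)), (Some (inr y)); split=> //; rewrite cx cy.
Qed.

Lemma nested_triangle_not_dicolorable n : ~ dicolorable (nested_triangle n) n.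
Proof.
move=> [c cP].
have [x|x [y [z [xy yz zx [cxy cyz]]]]] :=
  @nested_triangle_monochromatic n (iota 0 n) (fun x => nat_of_ord (c x)) _ (eq_leq (size_iota _ _)).
  by rewrite mem_iota add0n ltn_ord.
by apply: (dicoloring_triangle cP _ _ xy yz zx); apply: val_inj.
Qed.

(** * Shift graphs and the theorem *)

Section ShiftGraph.
Variable n : nat.

Definition shift_vertex : finType := ('I_n * 'I_n * 'I_n)%type.
Implicit Types u v : shift_vertex.

(** The shift graph on increasing triples, with [(x, y, z)] joined to [(y, z, w)]; all other triples
    are isolated. *)
Definition shift u v := [&& u.1.1 < u.1.2, u.1.2 < u.2, v.1.2 < v.2 &
  (u.1.2 == v.1.1 :> nat) && (u.2 == v.1.2 :> nat)].

Definition shift_graph u v := shift u v || shift v u.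

Lemma shift_graph_sym : symmetric shift_graph.
Proof. by move=> u v; rewrite /shift_graph orbC. Qed.

Lemma shift_graph_noC3 u v w :
  shift_graph u v -> shift_graph v w -> shift_graph w u -> False.
Proof. by rewrite /shift_graph /shift; lia. Qed.

Lemma shift_graph_noC5 u v w x y : shift_graph u v -> shift_graph v w ->
  shift_graph w x -> shift_graph x y -> shift_graph y u -> False.
Proof. by rewrite /shift_graph /shift; lia. Qed.

(** For a proper colouring [psi] is injective into sets of sets of colours. If [psi z = psi w] with
    [z < w], then [phi z w = phi y z] for some [y < z], so the colour of [(y, z, w)] is also that of
    some [(x, y, z)], an adjacent triple. *)
Lemma shift_graph_chromatic M (c : shift_vertex -> 'I_M) : #|{set {set 'I_M}}| < n ->
  exists u v, shift_graph u v /\ c u = c v.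
Proof.
move=> Mn; apply: contrapT => nc.
pose phi (y z : 'I_n) := [set c (x, y, z) | x : 'I_n & x < y].
pose psi (z : 'I_n) := [set phi y z | y : 'I_n & y < z].
have psi_neq (z w : 'I_n) : z < w -> psi z != psi w.
  move=> zw; apply/eqP => pzw.
  have : phi z w \in psi w by apply/imsetP; exists z; rewrite ?inE.
  rewrite -pzw => /imsetP[y]; rewrite inE => yz pe.
  have : c (y, z, w) \in phi z w by apply/imsetP; exists y; rewrite ?inE.
  rewrite pe => /imsetP[x]; rewrite inE => xy ce.
  apply: nc; exists (x, y, z), (y, z, w); split=> //.
  by rewrite /shift_graph /shift /=; lia.
have psi_inj : injective psi.
  move=> z w; have [zw|wz|/val_inj//] := ltngtP z w.
    by move=> /eqP; rewrite (negPf (psi_neq _ _ zw)).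
  by move=> /esym/eqP; rewrite (negPf (psi_neq _ _ wz)).
by have := leq_card _ psi_inj; rewrite card_ord leqNgt Mn.
Qed.

End ShiftGraph.

Lemma triangle_pentagon_free_chromatic M : exists (T : finType) (G : rel T),
  [/\ symmetric G, (forall u v w, G u v -> G v w -> G w u -> False),
      (forall u v w x y, G u v -> G v w -> G w x -> G x y -> G y u -> False) &
      forall c : T -> 'I_M, exists u v, G u v /\ c u = c v].
Proof.
exists (shift_vertex #|{set {set 'I_M}}|.+1), (@shift_graph _); split.
- exact: shift_graph_sym.
- exact: shift_graph_noC3.
- exact: shift_graph_noC5.
- by move=> c; apply: shift_graph_chromatic.
Qed.

(** * A tournament and a digraph with digons built from a graph *)

Section BackwardTournament.
Variables (T : finType) (G : rel T).
Hypothesis symG : symmetric G.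
Hypothesis noC3 : forall u v w, G u v -> G v w -> G w u -> False.
Hypothesis noC5 : forall u v w x y, G u v -> G v w -> G w x -> G x y -> G y u -> False.

Let rk (u : T) : nat := enum_rank u.

Lemma rk_inj : injective rk.
Proof. by move=> u v /val_inj/enum_rank_inj. Qed.

Definition back_arc : rel T := fun u v =>
  (u != v) && (if rk u < rk v then ~~ G u v else G u v).

Lemma back_arc_irrefl : irreflexive back_arc.
Proof. by move=> u; rewrite /back_arc eqxx. Qed.

Definition back_digraph := Digraph back_arc_irrefl.

Lemma back_tournament : tournament back_digraph.
Proof.
move=> u v uv; have vu : v != u by rewrite eq_sym.
rewrite /= /back_arc uv vu /=.
have ruv : rk u != rk v by rewrite (inj_eq rk_inj).
rewrite (symG v u); case: ltngtP ruv => //= _ _; by case: (G u v).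
Qed.

Lemma back_arcG u v : back_arc u v -> rk v < rk u -> G u v.
Proof. by move=> /andP[_]; case: ltngtP. Qed.

Lemma back_arc_rk u v : back_arc u v -> rk u != rk v.
Proof. by rewrite (inj_eq rk_inj) => /andP[]. Qed.

(** A directed triangle with vertices on both sides of rank [r] has to return across [r], along a
    backward arc, which is an edge of [G]. *)
Lemma back_triangle_crossing r x y z :
  back_arc x y -> back_arc y z -> back_arc z x ->
  {in [set x; y; z], forall u, rk u != r} ->
  (exists2 u, u \in [set x; y; z] & rk u < r) ->
  (exists2 u, u \in [set x; y; z] & r < rk u) ->
  exists u v, [/\ u \in [set x; y; z], v \in [set x; y; z],
    rk v < r, r < rk u & G u v].
Proof.
move=> xy yz zx ne [u uA ur] [v vA rv].
have Ax : x \in [set x; y; z] by rewrite !inE eqxx.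
have Ay : y \in [set x; y; z] by rewrite !inE eqxx orbT.
have Az : z \in [set x; y; z] by rewrite !inE eqxx orbT.
have lo : [|| rk x < r, rk y < r | rk z < r].
  by move: uA ur; rewrite !inE => /orP[/orP[]|] /eqP-> ->; rewrite ?orbT.
have hi : [|| r < rk x, r < rk y | r < rk z].
  by move: vA rv; rewrite !inE => /orP[/orP[]|] /eqP-> ->; rewrite ?orbT.
have := ne _ Ax; have := ne _ Ay; have := ne _ Az => nz ny nx.
have [[rx yr]|[[ry zr]|[rz xr]]] :
    (r < rk x /\ rk y < r) \/ (r < rk y /\ rk z < r) \/ (r < rk z /\ rk x < r) by lia.
- by exists x, y; split=> //; apply: back_arcG => //; apply: ltn_trans rx.
- by exists y, z; split=> //; apply: back_arcG => //; apply: ltn_trans ry.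
- by exists z, x; split=> //; apply: back_arcG => //; apply: ltn_trans rz.
Qed.

Lemma back_triangle_edge x y z : back_arc x y -> back_arc y z -> back_arc z x ->
  exists u v, [/\ u \in [set x; y; z], v \in [set x; y; z] & G u v].
Proof.
move=> xy yz zx.
have Ax : x \in [set x; y; z] by rewrite !inE eqxx.
have Ay : y \in [set x; y; z] by rewrite !inE eqxx orbT.
have Az : z \in [set x; y; z] by rewrite !inE eqxx orbT.
have := back_arc_rk xy; have := back_arc_rk yz; have := back_arc_rk zx => nzx nyz nxy.
have [yx|[zy|xz]] : rk y < rk x \/ rk z < rk y \/ rk x < rk z by lia.
- by exists x, y; split=> //; apply: back_arcG.
- by exists y, z; split=> //; apply: back_arcG.
- by exists z, x; split=> //; apply: back_arcG.
Qed.

(* With [x => A => B => x], a triangle of [A] and one of [B] both have vertices on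
   both sides of [x] in the ordering, for otherwise [G] has a triangle; edges [u v] of [A]
   and [u' v'] of [B] crossing [x] then give the 5-cycle [x v u v' u'] of [G]. *)
Lemma back_no_tri_triangles x A0 B0 : full back_arc [set x] A0 -> full back_arc A0 B0 ->
  full back_arc B0 [set x] -> triangle_in back_arc A0 -> triangle_in back_arc B0 -> False.
Proof.
move=> fxA fAB fBx [p0 [p1 [p2 [Ap0 Ap1 Ap2 [p01 p12 p20]]]]].
move=> [q0 [q1 [q2 [Bq0 Bq1 Bq2 [q01 q12 q20]]]]].
pose A := [set p0; p1; p2]; pose B := [set q0; q1; q2].
have sA u : u \in A -> u \in A0 by rewrite !inE => /orP[/orP[]|] /eqP->.
have sB u : u \in B -> u \in B0 by rewrite !inE => /orP[/orP[]|] /eqP->.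
have xA u : u \in A -> back_arc x u by move=> /sA Au; apply: fxA; rewrite ?inE.
have Bx u : u \in B -> back_arc u x by move=> /sB Bu; apply: fBx; rewrite ?inE.
have neA u : u \in A -> rk u != rk x by move=> /xA/back_arc_rk; rewrite eq_sym.
have neB u : u \in B -> rk u != rk x by move=> /Bx/back_arc_rk.
have Alo u : u \in A -> rk u < rk x -> G x u by move=> /xA xu ux; apply: back_arcG.
have Bhi u : u \in B -> rk x < rk u -> G u x by move=> /Bx ux xu; apply: back_arcG.
have [u0 [v0 [Au0 Av0 G0]]] := back_triangle_edge p01 p12 p20.
have [u1 [v1 [Bu1 Bv1 G1]]] := back_triangle_edge q01 q12 q20.
have cross a b : a \in A -> b \in B -> rk b < rk x -> rk x < rk a -> G a b.
  move=> /sA Aa /sB Bb bx xa; apply: back_arcG; first exact: fAB.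
  exact: ltn_trans xa.
have [a Aa xa] : exists2 a, a \in A & rk x < rk a.
  apply: contrapT => na.
  have lo u : u \in A -> G x u.
    move=> Au; apply: Alo => //; have := neA _ Au.
    by case: ltngtP => // xu _; case: na; exists u.
  by apply: (noC3 (lo _ Au0) G0); rewrite symG; apply: lo.
have [b Bb bx] : exists2 b, b \in B & rk b < rk x.
  apply: contrapT => nb.
  have hi u : u \in B -> G u x.
    move=> Bu; apply: Bhi => //; have := neB _ Bu.
    by case: ltngtP => // ux _; case: nb; exists u.
  by apply: (noC3 G1 (hi _ Bv1)); rewrite symG; apply: hi.
(* Otherwise [A] comes after [x], hence after [b], so its arcs to [b] are backward and an edge of
   [G] inside [A] completes a triangle with [b]. *)
have loA : exists2 a, a \in A & rk a < rk x.
  apply: contrapT => na.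
  have hi u : u \in A -> G u b.
    move=> Au; apply: cross => //; have := neA _ Au.
    by case: ltngtP => // ux _; case: na; exists u.
  by apply: (noC3 G0 (hi _ Av0)); rewrite symG; apply: hi.
have hiB : exists2 b, b \in B & rk x < rk b.
  apply: contrapT => nb.
  have lo u : u \in B -> G a u.
    move=> Bu; apply: cross => //; have := neB _ Bu.
    by case: ltngtP => // ux _; case: nb; exists u.
  by apply: (noC3 (lo _ Bu1) G1); rewrite symG; apply: lo.
have [|u [v [Au Av vx xu Guv]]] := back_triangle_crossing p01 p12 p20 neA loA.
  by exists a.
have [|u' [v' [Bu' Bv' vx' xu' Guv']]] := back_triangle_crossing q01 q12 q20 neB _ hiB.
  by exists b.
apply: (noC5 (Alo v Av vx) (w := u) (x := v') (y := u')).
- by rewrite symG.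
- exact: cross.
- by rewrite symG.
- exact: Bhi.
Qed.

(* In an acyclic set no vertex has [G]-neighbours on both sides, as it would
   complete a directed triangle with them. *)
Lemma back_dicolorable m : dicolorable back_digraph m ->
  exists c : T -> 'I_(m * 2), forall u v, G u v -> c u != c v.
Proof.
move=> [c cP].
(* The extra bit records whether [u] has a later [G]-neighbour of its own colour. If [u] and [v]
   agree in both, a third vertex [w] after [v] gives the monochromatic triangle [w], [v], [u]. *)
pose up u := [exists v, [&& rk u < rk v, G u v & c v == c u]].
have lt u : c u * 2 + up u < m * 2 by have := ltn_ord (c u); case: (up u); lia.
exists (fun u => Ordinal (lt u)).
have main u v : rk u < rk v -> G u v -> c u = c v -> up u = up v -> False.
  move=> uv Guv cuv; have -> : up u by apply/existsP; exists v; rewrite uv Guv cuv eqxx.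
  move=> /esym/existsP[w /and3P[vw Gvw /eqP cvw]].
  have ne s s' : rk s < rk s' -> s != s' by apply: contraTneq => ->; rewrite ltnn.
  have nuw : ~~ G u w by apply/negP => Guw; apply: (noC3 Guv Gvw); rewrite symG.
  have uw := ltn_trans uv vw.
  apply: (@dicoloring_triangle back_digraph m c w v u cP) => //=; rewrite /back_arc.
  - by rewrite eq_sym (ne v w) // ltnNge (ltnW vw) /= symG.
  - by rewrite eq_sym (ne u v) // ltnNge (ltnW uv) /= symG.
  - by rewrite (ne u w) // uw.
move=> u v Guv; apply/eqP => /(congr1 val) /= E.
have cuv : c u = c v by apply: val_inj => /=; move: E; case: (up u); case: (up v); lia.
have upuv : up u = up v by move: E; case: (up u); case: (up v); lia.
case: (ltngtP (rk u) (rk v)) => [uv|vu|/rk_inj uv].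
- exact: (main u v).
- by apply: (main v u) => //; rewrite symG.
- by apply: (noC3 (u := u) (v := u) (w := u)); rewrite {2}uv.
Qed.

Definition digon_arc : rel T := fun u v => (u != v) && (G u v || (rk u < rk v)).

Lemma digon_arc_irrefl : irreflexive digon_arc.
Proof. by move=> u; rewrite /digon_arc eqxx. Qed.

Definition digon_digraph := Digraph digon_arc_irrefl.

Lemma digon_arcG u v : digon_arc u v -> digon_arc v u -> G u v.
Proof.
move=> /andP[_ /orP[//|uv]] /andP[_ /orP[|vu]]; first by rewrite symG.
by have := ltn_trans uv vu; rewrite ltnn.
Qed.

Lemma G_irrefl u : G u u = false.
Proof. by apply/negP => Guu; apply: (noC3 Guu Guu Guu). Qed.

Lemma G_digon_arc u v : G u v -> digon_arc u v.
Proof.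
by move=> Guv; rewrite /digon_arc Guv andbT; apply: contraTneq Guv => ->; rewrite G_irrefl.
Qed.

(** Digons are edges of the triangle-free [G], and any two vertices are joined. The arcs of an
    induced tournament lie in no digon, so they all follow the ordering and form no directed
    triangle. *)
Lemma digon_digraph_Forb k alpha (H : digraph) : 2 < k -> 1 < alpha ->
  tournament H -> triangle_in (@arc H) setT ->
  Forb_ind (triple (complete_symmetric k) (edgeless alpha) H) digon_digraph.
Proof.
move=> k2 a1 tH tri F [->|[->|->]] /embedding_contains_induced[f fi fe].
- have arcf (i j : 'I_k) : i != j -> digon_arc (f i) (f j) by move=> ij; rewrite -[digon_arc _ _]/(arc (f i) (f j)) fe.
  have Gf (i j : 'I_k) : i != j -> G (f i) (f j).
    by move=> ij; apply: digon_arcG; apply: arcf; rewrite // eq_sym.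
  pose i0 := Ordinal (ltn_trans (isT : 0 < 2) k2).
  pose i1 := Ordinal (ltn_trans (isT : 1 < 2) k2).
  exact: (noC3 (Gf i0 i1 isT) (Gf i1 (Ordinal k2) isT) (Gf (Ordinal k2) i0 isT)).
- pose i0 : edgeless alpha := Ordinal (ltn_trans (isT : 0 < 1) a1).
  pose i1 : edgeless alpha := Ordinal a1.
  have ne : f i0 != f i1 by apply: contraTneq isT => /fi.
  have := fe i0 i1; have := fe i1 i0; rewrite /= /digon_arc ne eq_sym ne /=.
  move=> /norP[_ r10] /norP[_ r01].
  by move: ne; rewrite -(inj_eq rk_inj); move: r10 r01; case: ltngtP.
- have [x [y [z [_ _ _ [xy yz zx]]]]] := tri.
  have lt u v : arc u v -> rk (f u) < rk (f v).
    move=> uv; have := fe u v; rewrite uv => /andP[_ /orP[Guv|//]].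
    have := fe v u; rewrite (negPf (tournament_oriented tH uv)) /= => /negP; case.
    by apply: G_digon_arc; rewrite symG.
  by have := lt _ _ xy; have := lt _ _ yz; have := lt _ _ zx; lia.
Qed.

Lemma digon_dicolorable m : dicolorable digon_digraph m ->
  exists c : T -> 'I_m, forall u v, G u v -> c u != c v.
Proof.
move=> [c cP]; exists c => u v Guv; apply/eqP => cuv.
apply: (dicoloring_digon cP cuv); apply: G_digon_arc => //; by rewrite symG.
Qed.

End BackwardTournament.

Lemma hero_constructible (H : digraph) : hero H ->
  exists2 p, constructible p & fits (@arc H) p setT.
Proof.
move=> [tH [m Hm]].
have contains T : tournament T -> ~ dicolorable T m -> contains_induced T H.
  move=> tT nT; apply: contrapT => nH; apply: nT; apply/dichromatic_numberP.
  exact: Hm.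
have [f fi fe] := embedding_contains_induced
  (contains _ (@nested_triangle_tournament m) (@nested_triangle_not_dicolorable m)).
apply: (@fits_nested_pat_constructible _ _ m).
- exact: tournament_oriented.
- exact: tournament_total.
(* Twice [m] colours, because [back_dicolorable] doubles the number of colours. *)
- have [T [G [symG noC3 noC5 chi]]] := triangle_pentagon_free_chromatic (m * 2).
  have [|g gi ge] := embedding_contains_induced (contains _ (back_tournament symG) _).
    move=> /(back_dicolorable symG noC3)[c cP]; have [u [v [Guv]]] := chi c.
    by move/eqP; rewrite (negPf (cP u v Guv)).
  move=> x A B fxA fAB fBx tA tB.
  have img C D : full (@arc H) C D -> full (back_arc G) (g @: C) (g @: D).
    by move=> f0 _ _ /imsetP[u Cu ->] /imsetP[v Dv ->]; have := ge u v; rewrite f0.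
  have tri C : triangle_in (@arc H) C -> triangle_in (back_arc G) (g @: C).
    move=> [u [v [w [Cu Cv Cw [uv vw wu]]]]]; exists (g u), (g v), (g w).
    have := ge u v; have := ge v w; have := ge w u; rewrite uv vw wu /= => -> -> ->.
    by split; rewrite ?imset_f.
  apply: (back_no_tri_triangles symG noC3 noC5 (x := g x) (A0 := g @: A) (B0 := g @: B)).
  + by rewrite -imset_set1; apply: img.
  + exact: img.
  + by rewrite -imset_set1; apply: img.
  + exact: tri.
  + exact: tri.
- by apply: (@nested_triangle_fits m _ _ f); [move=> x y _ _; apply: fi|move=> x y _ _].
Qed.

(** * Finding the forbidden subdigraphs, and the equivalence *)

Lemma contains_complete_symmetric (D : digraph) k (Q : {set D}) : #|Q| = k ->
  {in Q &, forall x y, x != y -> arc x y} -> contains_induced D (complete_symmetric k).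
Proof.
move=> cQ hQ; pose f (i : 'I_k) : D := enum_val (cast_ord (esym cQ) i).
have fi : injective f by move=> i j /enum_val_inj/cast_ord_inj.
apply: (@contains_induced_embedding _ (complete_symmetric k) f fi) => i j /=.
have [->|ij] := eqVneq i j; first by rewrite arc_irrefl.
by apply: hQ; rewrite ?enum_valP // (inj_eq fi).
Qed.

Lemma contains_edgeless (D : digraph) n (Q : {set D}) : #|Q| = n ->
  {in Q &, forall x y, ~~ arc x y} -> contains_induced D (edgeless n).
Proof.
move=> cQ hQ; pose f (i : 'I_n) : D := enum_val (cast_ord (esym cQ) i).
have fi : injective f by move=> i j /enum_val_inj/cast_ord_inj.
apply: (@contains_induced_embedding _ (edgeless n) f fi) => i j /=.
by apply/negbTE; apply: hQ; rewrite enum_valP.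
Qed.

Lemma Forb_edgeless_alpha_lt (D : digraph) n X : ~ contains_induced D (edgeless n) ->
  alpha_lt (@arc D) n X.
Proof.
move=> nD I _ iI; rewrite ltnNge; apply/negP => /subset_of_card[Q [sQ cQ]].
apply: nD; apply: (contains_edgeless cQ) => x y Qx Qy.
by apply: iI; apply: (subsetP sQ).
Qed.

Theorem theorem7 (H : digraph) (k alpha : nat)
    (hH : hero H) (hk : 2 <= k) (halpha : 2 <= alpha) :
  heroic (triple (complete_symmetric k) (edgeless alpha) H) <->
  transitive_tournament H \/ k = 2.
Proof.
have tH : tournament H by have [] := hH.
have oH := tournament_oriented tH; have totH := tournament_total tH.
split.
  move=> [m Hm]; have [k2|k2] := eqVneq k 2; [by right|left; split=> //].
  apply: acy_acyclicT; apply: (no_triangle_acy oH totH) => tri.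
  have [T [G [symG noC3 _ chi]]] := triangle_pentagon_free_chromatic m.
  have k3 : 2 < k by rewrite ltn_neqAle eq_sym k2.
  have /Hm/dichromatic_numberP/(digon_dicolorable symG noC3)[c cP] :=
    digon_digraph_Forb symG noC3 k3 halpha tH tri.
  by have [u [v [Guv /eqP]]] := chi c; rewrite (negPf (cP u v Guv)).
move=> [[_ aH]|k2].
  have [l fl] : exists l, fits (@arc H) (TT l) setT.
    apply: acy_fits_TT => //; apply: no_triangle_acy => //.
    move=> [x [y [z [_ _ _ [xy yz zx]]]]]; apply: aH; exists [:: x; y; z]; split=> //.
    apply/andP; split; first by rewrite /= xy yz zx.
    have ne u v : arc u v -> (u == v :> H) = false.
      by move=> uv; apply/negbTE; apply: contraTneq uv => ->; rewrite arc_irrefl.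
    by rewrite /= !inE (ne x y) // (ne y z) // eq_sym (ne z x).
  (* Among [N] vertices there are [k] in mutual digons or [M] without digon; the latter contain
     [alpha] independent vertices or a copy of [TT l], hence of [H]. *)
  have [M HM] := oriented_TT alpha l; have [N HN] := ramsey k M.
  exists N => D FD.
  suff DN : #|D| < N.
    by apply/dichromatic_numberP; apply: dicolorable_leq (dicolorable_card D); apply: ltnW.
  rewrite ltnNge; apply/negP => ND.
  have sd : symmetric (fun x y : D => arc x y && arc y x) by move=> x y; rewrite andbC.
  have NT : N <= #|[set: D]| by rewrite cardsT.
  have [[Q [_ cQ hQ]]|[Q [_ cQ hQ]]] := HN D _ setT sd NT.
    apply: (FD (complete_symmetric k)); first by left.
    by apply: (contains_complete_symmetric cQ) => x y Qx Qy /(hQ x y Qx Qy)/andP[].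
  (* [oriented] speaks of the whole type, so the arcs are cut down to [Q], which has no digon. *)
  pose e : rel D := fun x y => [&& x \in Q, y \in Q & arc x y].
  have eQ : {in Q &, forall x y, e x y = arc x y} by move=> x y Qx Qy; rewrite /e Qx Qy.
  have oe : oriented e.
    move=> x y /and3P[Qx Qy xy]; rewrite eQ //; apply/negP => yx.
    have xy' : x != y by apply: contraTneq xy => ->; rewrite arc_irrefl.
    by have := hQ x y Qx Qy xy'; rewrite xy yx.
  have sQ : alpha_lt e alpha Q.
    have : alpha_lt (@arc D) alpha Q.
      by apply: Forb_edgeless_alpha_lt; apply: FD; right; left.
    move=> sQ I sI iI; apply: sQ => // x y Ix Iy.
    by rewrite -eQ ?(subsetP sI) //; apply: iI.
  apply: (FD H); first by right; right.
  by apply: (fits_contains_induced tH oe eQ fl); apply: HM; rewrite ?cQ.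
have [p cp fp] := hero_constructible hH.
have [m Hm] := constructible_superhero cp alpha.
exists m => D FD; apply/dichromatic_numberP; apply: col_dicolorable.
have oD : oriented (@arc D).
  move=> x y xy; apply/negP => yx; apply: (FD (complete_symmetric k)); first by left.
  have xy' : x != y by apply: contraTneq xy => ->; rewrite arc_irrefl.
  apply: (@contains_complete_symmetric _ _ [set x; y]); first by rewrite cards2 xy' k2.
  by move=> u v; rewrite !inE => /orP[]/eqP-> /orP[]/eqP->; rewrite ?eqxx.
apply: Hm => //.
  by apply: Forb_edgeless_alpha_lt; apply: FD; right; left.
by move=> oX; apply: (FD H); [right; right|apply: (fits_contains_induced tH oD _ fp oX)].
Qed.
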